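(* Let $\Sigma$ be distributed according to the uniform biased sparse PCA (UBSPCA) model with parameters $n,p,k,\beta$, with $p/n\to c>0$. Set $\Gamma=C\left(\frac{(1+\beta)k\log n}{n}\right)^{0.5}$ for a suitably chosen constant $C$. With probability tending to $1$ as $(n,p,k)\to\infty$, for every $\delta\in[0,1]$ and for every set $\mathcal{I}\subseteq\{1,\ldots,p\}$ of size $k$ that satisfies $|\mathcal{I}\cap\mathcal{I}^*|=\delta k$, $$\lambda_1(\Sigma_{\mathcal{I}})\in\left[1+\delta\beta-\Gamma,\;1+\delta\beta+\Gamma+\frac{\beta}{k}\right].$$
   Context: UBSPCA model: $\mathbf{v}^*\in\mathbb{R}^p$ is a unit vector with exactly $k$ non-zero entries, all equal to $1/\sqrt{k}$, and $\mathcal{I}^*\subseteq\{1,\ldots,p\}$ is its support, $|\mathcal{I}^*|=k$. The signal strength is $\beta\ge0$. The samples $\mathbf{x}_1,\ldots,\mathbf{x}_n\in\mathbb{R}^p$ are i.i.d. from $\mathcal{N}(0,\beta\mathbf{v}^*{\mathbf{v}^*}^T+I_p)$, $X$ is the $n\times p$ matrix whose rows are the samples, and $\Sigma=\frac1n X^TX$. Probability is over the choice of $X$. For $\mathcal{S}\subseteq\{1,\ldots,p\}$, $\Sigma_{\mathcal{S}}$ is the principal submatrix of $\Sigma$ with rows and columns indexed by $\mathcal{S}$, and $\lambda_1(\cdot)$ denotes the largest eigenvalue. *)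

(* Defs.v *)
From HB Require Import structures.
From mathcomp Require Import all_boot all_order all_algebra.
From mathcomp Require Import all_classical all_reals all_analysis.

Set Implicit Arguments.
Unset Strict Implicit.
Unset Printing Implicit Defensive.

Import Order.TTheory GRing.Theory Num.Theory.
Import numFieldNormedType.Exports.

Local Open Scope classical_set_scope.
Local Open Scope ring_scope.

Section linear_algebra.
Context {R : realType}.

Definition principal_submx (p : nat) (A : 'M[R]_p) (S : {set 'I_p}) :
    'M[R]_#|S| :=
  mxsub (fun i => enum_val i) (fun i => enum_val i) A.

(* A real symmetric matrix of positive size has a nonempty finite set of
   eigenvalues, so that this supremum is then a maximum. *)
Definition lambda1 (q : nat) (A : 'M[R]_q) : R := sup [set a | eigenvalue A a].

Definition vsupport (p : nat) (v : 'cV[R]_p) : {set 'I_p} :=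
  [set j | v j ord0 != 0]%SET.

Definition uniform_spike (p k : nat) (v : 'cV[R]_p) : Prop :=
  [/\ \sum_j v j ord0 ^+ 2 = 1,
      #|vsupport v| = k &
      forall j, j \in vsupport v -> v j ord0 = 1 / Num.sqrt k%:R].

End linear_algebra.

Section probability_notions.
Context {R : realType}.

(* The normal law of mean m and variance s; [normal_prob] takes the standard
   deviation, and for a null one it is not the Dirac mass. *)
Definition normal_law (m s : R) (A : set R) : \bar R :=
  if s == 0 then \d_m A else normal_prob m (Num.sqrt s) A.

Context {d : measure_display} {T : measurableType d} (P : probability T R).

Definition mutually_independent {d' : measure_display} {T' : measurableType d'}
    (I : finType) (x : I -> {RV P >-> T'}) : Prop :=
  forall (J : {set I}) (B : I -> set T'), (forall i, measurable (B i)) ->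
    P [set w | forall i, i \in J -> B i (x i w)] =
    (\big[mule/1]_(i in J) P (x i @^-1` B i))%E.

(* Multivariate normal law, possibly degenerate: every linear form is normal. *)
Definition gaussian_vector (p : nat) (mu : 'cV[R]_p) (K : 'M[R]_p)
    (x : {RV P >-> p.-tuple R}) : Prop :=
  forall (a : 'cV[R]_p) (A : set R), measurable A ->
    P [set w | A (\sum_j a j ord0 * tnth (x w) j)] =
    normal_law ((a^T *m mu) ord0 ord0) ((a^T *m K *m a) ord0 ord0) A.

Definition sample_mx (n p : nat) (x : 'I_n -> {RV P >-> p.-tuple R}) (w : T) :
    'M[R]_(n, p) :=
  \matrix_(i < n, j < p) tnth (x i w) j.

Definition sample_cov (n p : nat) (x : 'I_n -> {RV P >-> p.-tuple R}) (w : T) :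
    'M[R]_p :=
  n%:R^-1 *: ((sample_mx x w)^T *m sample_mx x w).

Definition UBSPCA (n p k : nat) (beta : R) (v : 'cV[R]_p)
    (x : 'I_n -> {RV P >-> p.-tuple R}) : Prop :=
  [/\ uniform_spike k v,
      mutually_independent x &
      forall i, gaussian_vector 0 (beta *: (v *m v^T) + 1%:M) (x i)].

End probability_notions.

Definition Gamma {R : realType} (C beta : R) (n k : nat) : R :=
  C * Num.sqrt ((1 + beta) * k%:R * ln n%:R / n%:R).

(* Main.v *)
(* Write [K] for the population covariance [1 + beta v v^T], which has inverse
   square root [whiten_mx], and [M] for the deviation of the whitened sample
   covariance from the identity.  For a fixed unit [u], the form [u^T M u] is a
   centred chi-square average, with Bernstein-type tails.  A union bound over
   lattice nets of the balls of [R^(I u S)], [S] the support of [v] and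
   [#|I| = k], whose number of points has logarithm of order [min (k ln n) n],
   bounds [M] on all these subspaces by a multiple of
   [sqrt (min (k ln n / n) 1)].  Undoing the whitening would cost a factor
   [1 + beta]; but only [v^T M v] gets that factor, and since it concerns a
   single vector it has a much smaller deviation, while the rest is multiplied by
   [sqrt (1 + beta)] only.  Rayleigh quotients then give both bounds. *)

Require Import Defs.
From HB Require Import structures.
From mathcomp Require Import all_boot all_order all_algebra.
From mathcomp Require Import all_classical all_reals all_analysis.
From mathcomp Require Import measurable_realfun ring lra.

Set Implicit Arguments.
Unset Strict Implicit.
Unset Printing Implicit Defensive.

Import Order.TTheory GRing.Theory Num.Theory.
Import numFieldNormedType.Exports.

Local Open Scope classical_set_scope.
Local Open Scope ring_scope.

(** * Quadratic forms and the largest eigenvalue *)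

Section forms.
Context {R : realType}.

(** No relation between [k ln n] and [n] is assumed, and this shapes the counting. The chi-square
    tail is [exp (- n s min(s, 1) / 16)]: a threshold [s] of order [sqrt (k ln n / n)] far above 1
    only has an exponent of order [n s], which may lose against a union over [exp (k ln n)] points.
    So the points are also counted by [exp (O(n))], which [p = O(n)] allows, and every threshold is
    a multiple of some [sqrt t] with [t <= 1]. For this second count each single net must have
    [exp (O(k))] points, without a logarithm in the exponent. The direction [v] gets its own
    threshold, smaller by a factor [sqrt (1 + beta)]. This turns the factor [1 + beta] into the
    square root allowed by [Gamma], at the price of dividing the tail exponent by [1 + beta]. As
    that exponent is still at least of order [min(k, n) / (1 + beta)] and [beta] is fixed, the
    failure probability vanishes, with a constant that depends on [c] only. *)

Definition dot {p} (u v : 'cV[R]_p) : R := \sum_j u j ord0 * v j ord0.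

Definition nsq {p} (u : 'cV[R]_p) : R := dot u u.

Definition bil {p} (M : 'M[R]_p) (u v : 'cV[R]_p) : R := dot u (M *m v).

Definition supported {p} (J : {set 'I_p}) (u : 'cV[R]_p) :=
  forall j, j \notin J -> u j ord0 = 0.

Variable p : nat.
Implicit Types (u v w x y z : 'cV[R]_p) (M : 'M[R]_p) (J : {set 'I_p}).

Lemma dotC u v : dot u v = dot v u.
Proof. by apply: eq_bigr => j _; rewrite mulrC. Qed.

Lemma dotDl u v w : dot (u + v) w = dot u w + dot v w.
Proof. by rewrite -big_split; apply: eq_bigr => j _; rewrite mxE mulrDl. Qed.

Lemma dotZl a u v : dot (a *: u) v = a * dot u v.
Proof. by rewrite mulr_sumr; apply: eq_bigr => j _; rewrite mxE mulrA. Qed.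

Lemma dotDr u v w : dot u (v + w) = dot u v + dot u w.
Proof. by rewrite dotC dotDl !(dotC u). Qed.

Lemma dotZr a u v : dot u (a *: v) = a * dot u v.
Proof. by rewrite dotC dotZl (dotC u). Qed.

Lemma dot_mulmx q (A : 'M[R]_(p, q)) u (v : 'cV[R]_q) :
  dot u (A *m v) = dot (A^T *m u) v.
Proof.
have dotE r (a b : 'cV[R]_r) : dot a b = (a^T *m b) ord0 ord0.
  by rewrite mxE; apply: eq_bigr => j _; rewrite mxE.
by rewrite !dotE trmx_mul trmxK mulmxA.
Qed.

Lemma bilDl M u v w : bil M (u + v) w = bil M u w + bil M v w.
Proof. exact: dotDl. Qed.

Lemma bilDr M u v w : bil M u (v + w) = bil M u v + bil M u w.
Proof. by rewrite /bil mulmxDr dotDr. Qed.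

Lemma bilZl M a u v : bil M (a *: u) v = a * bil M u v.
Proof. exact: dotZl. Qed.

Lemma bilZr M a u v : bil M u (a *: v) = a * bil M u v.
Proof. by rewrite /bil -scalemxAr dotZr. Qed.

Lemma bilC M u v : M^T = M -> bil M u v = bil M v u.
Proof. by move=> sM; rewrite /bil dot_mulmx sM dotC. Qed.

Lemma nsq_ge0 u : 0 <= nsq u.
Proof. by apply: sumr_ge0 => j _; rewrite -expr2 sqr_ge0. Qed.

Lemma nsq_eq0 u : nsq u = 0 -> u = 0.
Proof.
move=> /eqP; rewrite psumr_eq0; last by move=> j _; rewrite -expr2 sqr_ge0.
move=> /allP h; apply/matrixP => i j; rewrite ord1 mxE.
by have /implyP/(_ isT) := h i (mem_index_enum _); rewrite -expr2 sqrf_eq0 => /eqP.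
Qed.

Lemma nsqZ a u : nsq (a *: u) = a ^+ 2 * nsq u.
Proof. by rewrite /nsq dotZl dotZr mulrA. Qed.

Lemma nsqD u v : nsq (u + v) = nsq u + 2 * dot u v + nsq v.
Proof. by rewrite /nsq dotDl !dotDr (dotC v u); ring. Qed.

Lemma parallelogram u v : nsq (u + v) + nsq (u - v) = 2 * (nsq u + nsq v).
Proof. by rewrite -scaleN1r !nsqD nsqZ dotZr; ring. Qed.

Lemma sqr_coord_le u j : u j ord0 ^+ 2 <= nsq u.
Proof.
rewrite /nsq /dot (bigD1 j)//= -expr2 lerDl.
by apply: sumr_ge0 => i _; rewrite -expr2 sqr_ge0.
Qed.

Lemma cauchy_schwarz u v : dot u v ^+ 2 <= nsq u * nsq v.
Proof.
have [/nsq_eq0 ->|v0] := eqVneq (nsq v) 0.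
  by rewrite -(scale0r (0 : 'cV_p)) dotZr nsqZ expr0n/= !mul0r expr0n mulr0.
have vp : 0 < nsq v by rewrite lt_def v0 nsq_ge0.
have := nsq_ge0 (nsq v *: u - dot u v *: v).
rewrite -scaleNr nsqD !nsqZ dotZl dotZr.
rewrite (_ : _ + _ = nsq v * (nsq u * nsq v - dot u v ^+ 2)); last by ring.
by rewrite pmulr_rge0// subr_ge0.
Qed.

(** A crude entrywise estimate, for places where any finite bound will do: finiteness of a supremum,
    and control of rounding errors. *)
Lemma bil_bound M u v (a b : R) : (forall j, `|u j ord0| <= a) ->
  (forall j, `|v j ord0| <= b) ->
  `|bil M u v| <= a * b * \sum_i \sum_j `|M i j|.
Proof.
move=> ua vb; rewrite /bil /dot (le_trans (ler_norm_sum _ _ _))//.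
rewrite mulr_sumr; apply: ler_sum => i _; rewrite normrM mxE -mulrA.
apply: ler_pM => //; rewrite (le_trans (ler_norm_sum _ _ _))//.
rewrite mulr_sumr; apply: ler_sum => j _.
by rewrite normrM mulrC ler_wpM2r.
Qed.

Lemma supportedD J u v : supported J u -> supported J v -> supported J (u + v).
Proof. by move=> hu hv j hj; rewrite mxE hu// hv// addr0. Qed.

Lemma supportedZ J a u : supported J u -> supported J (a *: u).
Proof. by move=> hu j hj; rewrite mxE hu// mulr0. Qed.

Lemma supportedB J u v : supported J u -> supported J v -> supported J (u - v).
Proof.
by move=> hu hv; apply: supportedD => //; rewrite -scaleN1r; exact: supportedZ.
Qed.

Lemma normalize u : nsq u != 0 ->
  nsq ((Num.sqrt (nsq u))^-1 *: u) = 1 /\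
  u = Num.sqrt (nsq u) *: ((Num.sqrt (nsq u))^-1 *: u).
Proof.
move=> u0; have up : 0 < nsq u by rewrite lt_def u0 nsq_ge0.
split; first by rewrite nsqZ exprVn sqr_sqrtr ?nsq_ge0// mulVf.
by rewrite scalerA mulfV ?scale1r// gt_eqF// sqrtr_gt0.
Qed.

Lemma bil_le_nsq M J (S : R) :
  (forall u, supported J u -> nsq u <= 1 -> `|bil M u u| <= S) ->
  forall u, supported J u -> `|bil M u u| <= S * nsq u.
Proof.
move=> h u uJ; have [u0|u0] := eqVneq (nsq u) 0.
  rewrite u0 (nsq_eq0 u0) mulr0 -(scale0r (0 : 'cV_p)) bilZl mul0r normr0//.
have [u1 uE] := normalize u0.
rewrite {1 2}uE bilZl bilZr mulrA -expr2 sqr_sqrtr ?nsq_ge0//.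
rewrite normrM (ger0_norm (nsq_ge0 _)) mulrC ler_wpM2r ?nsq_ge0//.
by apply: h; rewrite ?u1//; exact: supportedZ.
Qed.

(** Polarization loses no constant here: by the parallelogram law the squared norms of [u + v] and
    [u - v] add up to at most 4, which cancels the factor 4 of the polarization identity. *)
Lemma bil_polarization M J (S : R) : M^T = M ->
  (forall u, supported J u -> nsq u <= 1 -> `|bil M u u| <= S) ->
  forall u v, supported J u -> supported J v -> nsq u <= 1 -> nsq v <= 1 ->
  `|bil M u v| <= S.
Proof.
move=> sM h u v uJ vJ u1 v1.
have S0 : 0 <= S.
  by apply: le_trans (h u uJ u1).
have E : 4 * bil M u v = bil M (u + v) (u + v) - bil M (u - v) (u - v).
  rewrite -(scaleN1r v) !(bilDl, bilDr, bilZl, bilZr) (bilC v u sM); ring.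
have h4 : `|4 * bil M u v| <= 4 * S.
  rewrite E (le_trans (ler_normB _ _))//.
  have /= A := bil_le_nsq h (supportedD uJ vJ).
  have /= B := bil_le_nsq h (supportedB uJ vJ).
  rewrite (le_trans (lerD A B))// -mulrDr parallelogram mulrC ler_wpM2r//.
  by lra.
by move: h4; rewrite normrM ger0_norm// ler_pM2l.
Qed.

(** A self-bounding argument: with [E] the values of the form on the ball, passing from [u] to a
    nearby [z] costs at most half of [sup E], so [sup E <= e + sup E / 2]. Subtracting is legitimate
    because [sup E] is finite. *)
Lemma bil_le_net M J (s : seq 'cV[R]_p) (e : R) : M^T = M ->
  (forall u, supported J u -> nsq u <= 1 -> exists z,
    [/\ z \in s, supported J z, nsq z <= 1 & nsq (u - z) <= 16^-1]) ->
  (forall z, z \in s -> nsq z <= 1 -> `|bil M z z| <= e) ->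
  forall u, supported J u -> nsq u <= 1 -> `|bil M u u| <= 2 * e.
Proof.
move=> sM net hs.
pose E := [set `|bil M u u| | u in [set u | supported J u /\ nsq u <= 1]].
have supE : has_sup E.
  split.
    exists `|bil M 0 0|; exists 0 => //=; split.
      by move=> j _; rewrite mxE.
    by rewrite -(scale0r (0 : 'cV_p)) nsqZ expr0n mul0r.
  exists (1 * 1 * \sum_i \sum_j `|M i j|) => _ [u [uJ u1] <-].
  have hu j : `|u j ord0| <= 1.
    rewrite -(@ler_pXn2r _ 2) ?nnegrE// expr1n real_normK ?num_real//.
    exact: le_trans (sqr_coord_le u j) u1.
  exact: bil_bound.
have hE u : supported J u -> nsq u <= 1 -> `|bil M u u| <= sup E.
  by move=> uJ u1; apply: sup_upper_bound => //; exists u.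
have pol := bil_polarization sM hE.
have half : sup E <= e + 2^-1 * sup E.
  apply: ge_sup; first by case: supE.
  move=> _ [u [uJ u1] <-]; have [z [zs zJ z1 uz]] := net u uJ u1.
  (* By symmetry the error is [bil M (u - z) (u + z)]. The squared mesh [16^-1] is chosen so that
     [4 (u - z)] lies in the unit ball, as does the midpoint of [u] and [z]; rescaling leaves the
     factor one half. *)
  have -> : bil M u u = bil M z z + 2^-1 * bil M (4 *: (u - z)) (2^-1 *: (u + z)).
    rewrite bilZl bilZr -(scaleN1r z) !(bilDl, bilDr, bilZl, bilZr) (bilC z u sM).
    by field.
  rewrite (le_trans (ler_normD _ _))// lerD ?hs// normrM ger0_norm//.
  rewrite ler_pM2l//; apply: pol.
  - exact/supportedZ/supportedB.
  - exact/supportedZ/supportedD.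
  - by rewrite nsqZ; lra.
  - have := parallelogram u z; have := nsq_ge0 (u - z).
    by rewrite nsqZ; lra.
move=> u uJ u1; apply: le_trans (hE u uJ u1) _; lra.
Qed.

End forms.

Section top_eigenvalue.
Context {R : realType}.

(** First-order condition at an extremum. A small step against the sign of [b], namely
    [t = - b / (1 + |a|)], makes the linear term outweigh the quadratic one. *)
Lemma quadratic_ge0_lin (a b : R) :
  (forall t, 0 <= 2 * t * b + t ^+ 2 * a) -> b = 0.
Proof.
move=> h; apply/eqP/negPn/negP => b0.
have a1 : 0 < 1 + `|a| by rewrite ltr_pwDl.
have := h (- b / (1 + `|a|)).
rewrite (_ : _ + _ = (b / (1 + `|a|)) ^+ 2 * (a - 2 * (1 + `|a|))); last first.
  by field; rewrite gt_eqF.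
rewrite pmulr_rge0; last first.
  by rewrite exprn_even_gt0//= mulf_neq0// invr_eq0 gt_eqF.
have := ler_norm a; have := normr_ge0 a; lra.
Qed.

(** The unit sphere is compact, so the form attains its maximum there, and homogeneity extends the
    inequality to all vectors. The sphere is taken in row vectors to fit the extreme value
    theorem. *)
Lemma rayleigh_max (q : nat) (A : 'M[R]_q) : (0 < q)%N ->
  exists u : 'cV[R]_q, nsq u = 1 /\ forall v, bil A v v <= bil A u u * nsq v.
Proof.
case: q A => // q A _.
pose f (u : 'rV[R]_q.+1) : R := bil A u^T u^T.
pose S := [set u : 'rV[R]_q.+1 | nsq u^T = 1].
have coordc j : continuous (fun u : 'rV[R]_q.+1 => u ord0 j).
  by move=> u; exact: coord_continuous.
have nsqE (u : 'rV[R]_q.+1) : nsq u^T = \sum_j u ord0 j * u ord0 j.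
  by apply: eq_bigr => j _; rewrite !mxE.
have fE u : f u = \sum_i u ord0 i * \sum_j A i j * u ord0 j.
  rewrite /f /bil /dot; apply: eq_bigr => i _; rewrite !mxE; congr (_ * _).
  by apply: eq_bigr => j _; rewrite mxE.
have sumc (F : 'I_q.+1 -> 'rV[R]_q.+1 -> R) : (forall i, continuous (F i)) ->
    continuous (fun u => \sum_i F i u).
  by move=> Fc; apply: (continuous_big (@add_continuous R)) => i _.
have nsqc : continuous (fun u : 'rV[R]_q.+1 => nsq u^T).
  rewrite (_ : (fun u : 'rV[R]_q.+1 => nsq u^T) =
      fun u : 'rV[R]_q.+1 => \sum_j u ord0 j * u ord0 j).
    by apply: sumc => j u; exact: (continuousM (coordc j u) (coordc j u)).
  by apply/funext => u; exact: nsqE.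
have fc : continuous f.
  rewrite (_ : f = fun u : 'rV[R]_q.+1 => \sum_i u ord0 i * \sum_j A i j * u ord0 j).
    have ic i : continuous (fun u : 'rV[R]_q.+1 => \sum_j A i j * u ord0 j).
      apply: sumc => j u.
      exact: (continuousM (@cst_continuous _ _ (A i j) u) (coordc j u)).
    by apply: sumc => i u; exact: (continuousM (coordc i u) (ic i u)).
  by apply/funext => u; exact: fE.
have Sc : closed S.
  rewrite (_ : S = (fun u : 'rV[R]_q.+1 => nsq u^T) @^-1` [set 1]); last by [].
  apply: (closed_comp (fun u _ => nsqc u)).
  exact: closed_eq.
have Sb : bounded_set S.
  exists 1; split; first exact: num_real.
  move=> M M1 u /= Su; rewrite [leLHS]mx_normrE.
  apply: bigmax_le; first by lra.
  move=> [i j] _ /=; rewrite ord1.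
  have := sqr_coord_le u^T j; rewrite Su mxE => h.
  apply: (@le_trans _ _ 1); last exact: ltW.
  by rewrite -(@ler_pXn2r _ 2) ?nnegrE// expr1n real_normK ?num_real.
have S0 : S !=set0.
  exists (delta_mx ord0 ord0); rewrite /S/= nsqE (bigD1 ord0)//= big1.
    by rewrite mxE !eqxx mulr1 addr0.
  by move=> j /negbTE j0; rewrite mxE j0 andbF mulr0.
have [c cS cmax] := EVT_max_rV S0 (bounded_closed_compact Sb Sc)
  (continuous_subspaceT fc).
exists c^T; split; first by move: cS; rewrite inE.
move=> v; have [v0|v0] := eqVneq (nsq v) 0.
  by rewrite v0 (nsq_eq0 v0) mulr0 -(scale0r (0 : 'cV_q.+1)) bilZl mul0r.
have [v1 vE] := normalize v0.
rewrite {1 2}vE bilZl bilZr mulrA -expr2 sqr_sqrtr ?nsq_ge0//.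
rewrite mulrC ler_wpM2r ?nsq_ge0//.
set y := _ *: v; rewrite -[y]trmxK; apply: cmax.
by rewrite inE /S/= trmxK.
Qed.

(** A maximiser [u] of the Rayleigh quotient is an eigenvector: moving [u] in the direction of the
    residual [r = A u - m u] changes the quotient to first order by a multiple of the squared norm
    of [r], which must therefore vanish. Any eigenvalue is itself a Rayleigh quotient, hence at most
    [m]. *)
Lemma lambda1_rayleigh (q : nat) (A : 'M[R]_q) : (0 < q)%N -> A^T = A ->
  (exists u : 'cV[R]_q, nsq u = 1 /\ bil A u u = lambda1 A) /\
  (forall v : 'cV[R]_q, bil A v v <= lambda1 A * nsq v).
Proof.
move=> q0 sA; have [u [u1 umax]] := rayleigh_max A q0.
suff lE : lambda1 A = bil A u u by rewrite lE; split => //; exists u.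
have eig : A *m u = bil A u u *: u.
  apply/eqP; rewrite -subr_eq0; apply/eqP; set m := bil A u u.
  have [r rE] : exists r, r = A *m u - m *: u by eexists.
  rewrite -rE.
  apply: nsq_eq0; suff : - nsq r = 0 by move/eqP; rewrite oppr_eq0 => /eqP.
  apply: (@quadratic_ge0_lin (m * nsq r - bil A r r)) => t.
  have := umax (u + t *: r).
  rewrite -/m nsqD nsqZ dotZr u1 !(bilDl, bilDr, bilZl, bilZr).
  rewrite (bilC r u sA).
  have -> : nsq r = bil A u r - m * dot u r.
    rewrite {1}/nsq {2}rE -scaleNr dotDr dotZr mulNr (dotC r u).
    by rewrite -/(bil A r u) bilC.
  rewrite -/m; lra.
have emax a : eigenvalue A a -> a <= bil A u u.
  move=> /eigenvalueP[w wA w0].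
  have : bil A w^T w^T = a * nsq w^T.
    by rewrite /bil -{1}sA -trmx_mul wA linearZ/= dotZr.
  move=> h; have := umax w^T; rewrite h ler_pM2r// lt_def nsq_ge0 andbT.
  apply: contra w0 => /eqP/nsq_eq0 /(congr1 trmx).
  by rewrite trmxK trmx0 => ->.
have umem : [set a | eigenvalue A a] (bil A u u).
  apply/eigenvalueP; exists u^T.
    by rewrite -{1}sA -trmx_mul eig linearZ.
  apply/eqP => /(congr1 trmx); rewrite trmxK trmx0 => u0.
  move: u1; rewrite u0 -(scale0r (0 : 'cV_q)) nsqZ expr0n mul0r => /eqP.
  by rewrite eq_sym oner_eq0.
apply/eqP; rewrite eq_le; apply/andP; split.
  by apply: ge_sup; [exists (bil A u u)|move=> a /emax].
apply: sup_upper_bound => //; split; first by exists (bil A u u).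
by exists (bil A u u) => a /emax.
Qed.

Lemma lambda1_leP (q : nat) (A : 'M[R]_q) (b : R) : (0 < q)%N -> A^T = A ->
  lambda1 A <= b <-> forall v : 'cV[R]_q, bil A v v <= b * nsq v.
Proof.
move=> q0 sA; have [[u [u1 uE]] h] := lambda1_rayleigh q0 sA; split=> [lb v|hb].
  by rewrite (le_trans (h v))// ler_wpM2r ?nsq_ge0.
by rewrite -uE (le_trans (hb u))// u1 mulr1.
Qed.

(** Reduces a condition on all real vectors to countably many, as measurability of [lambda1]
    requires. If [v] violated the bound by [eta], then [N v] would violate it by [N^2 eta], while
    rounding [N v] to an integer vector costs only a term linear in [N]. *)
Lemma bil_le_int (q : nat) (A : 'M[R]_q) (b : R) :
  (forall m : {ffun 'I_q -> int},
    bil A (\col_j (m j)%:~R) (\col_j (m j)%:~R)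
      <= b * nsq (\col_j (m j)%:~R : 'cV[R]_q)) ->
  forall v : 'cV[R]_q, bil A v v <= b * nsq v.
Proof.
move=> hm v; rewrite leNgt; apply/negP => vb.
pose B := A - b%:M.
have BE x y : bil B x y = bil A x y - b * dot x y.
  by rewrite /bil mulmxBl -scaleN1r dotDr dotZr mul_scalar_mx dotZr mulN1r.
pose eta := bil B v v.
have eta0 : 0 < eta by rewrite /eta BE subr_gt0.
have hB (m : {ffun 'I_q -> int}) :
    bil B (\col_j (m j)%:~R) (\col_j (m j)%:~R) <= 0.
  by rewrite BE subr_le0; exact: hm.
pose C := \sum_i \sum_j `|B i j|.
pose U := \sum_j `|v j ord0|.
have vU j : `|v j ord0| <= U.
  by rewrite /U (bigD1 j)//= lerDl; apply: sumr_ge0.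
have C0 : 0 <= C by apply: sumr_ge0 => i _; apply: sumr_ge0.
have U0 : 0 <= U by apply: sumr_ge0.
have key (N : nat) : (0 < N)%N -> N%:R * eta <= 2 * U * C + C.
  move=> N0; have NR : (0 : R) < N%:R by rewrite ltr0n.
  have NR1 : (1 : R) <= N%:R by rewrite ler1n.
  pose m := [ffun j => Num.floor (N%:R * v j ord0)].
  pose x : 'cV[R]_q := \col_j (m j)%:~R.
  have [e eE] : exists e, e = N%:R *: v - x by eexists.
  have he j : `|e j ord0| <= 1.
    rewrite eE !mxE ffunE; set y := _ * _.
    have := ge_floor y; have := floorD1_gt y; rewrite intrD => h1 h2.
    by rewrite ler_norml; lra.
  have xE : x = N%:R *: v - e by rewrite eE opprB addrCA subrr addr0.
  have := hB m; rewrite -/x xE -(scaleN1r e) !(bilDl, bilDr, bilZl, bilZr) -/eta.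
  have b1 := bil_bound B vU he; have b2 := bil_bound B he vU.
  have b3 := bil_bound B he he.
  move: b1 b2 b3; rewrite -/C !ler_norml => /andP[_ b1] /andP[_ b2] /andP[b3 _] h.
  have h' : N%:R * (N%:R * eta) <= N%:R * (bil B v e + bil B e v) - bil B e e by lra.
  have : N%:R * (N%:R * eta) <= N%:R * (2 * U * C + C).
    apply: le_trans h' _; rewrite [leRHS]mulrDr; apply: lerD.
      rewrite ler_pM2l// -mulrA (mulr_natl _ 2) mulr2n; apply: lerD.
        by rewrite mulr1 in b1.
      by rewrite mul1r in b2.
    by apply: (@le_trans _ _ C); [lra|rewrite ler_peMl].
  by rewrite ler_pM2l.
pose N := (Num.truncn ((2 * U * C + C) / eta)).+1.
have := key N isT; rewrite leNgt => /negP; apply.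
rewrite -ltr_pdivrMr//; exact: truncnS_gt.
Qed.

End top_eigenvalue.

Section principal.
Context {R : realType} (p : nat) (I : {set 'I_p}).

Definition embed_mx : 'M[R]_(p, #|I|) := \matrix_(j, i) (j == enum_val i)%:R.

Lemma embed_mxE (u : 'cV[R]_#|I|) i : (embed_mx *m u) (enum_val i) ord0 = u i ord0.
Proof.
rewrite mxE (bigD1 i)//= mxE eqxx mul1r big1 ?addr0// => k ki.
by rewrite mxE (inj_eq enum_val_inj) eq_sym (negbTE ki) mul0r.
Qed.

Lemma supported_embed (u : 'cV[R]_#|I|) : supported I (embed_mx *m u).
Proof.
move=> j jI; rewrite mxE big1// => i _; rewrite mxE.
by case: eqP => [jE|_]; rewrite ?mul0r//; rewrite jE enum_valP in jI.
Qed.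

Lemma dot_supported (w v : 'cV[R]_p) : supported I w ->
  dot w v = \sum_(i < #|I|) w (enum_val i) ord0 * v (enum_val i) ord0.
Proof.
move=> wI; rewrite /dot (bigID (mem I))/= [X in _ + X]big1 ?addr0; last first.
  by move=> j jI; rewrite wI// mul0r.
exact: big_enum_val.
Qed.

Lemma nsq_embed (u : 'cV[R]_#|I|) : nsq (embed_mx *m u) = nsq u.
Proof.
rewrite /nsq (dot_supported _ (supported_embed u)).
by apply: eq_bigr => i _; rewrite embed_mxE.
Qed.

Lemma principal_submxE (A : 'M[R]_p) (u : 'cV[R]_#|I|) :
  bil (principal_submx A I) u u = bil A (embed_mx *m u) (embed_mx *m u).
Proof.
rewrite /bil (dot_supported _ (supported_embed u)) /dot.
apply: eq_bigr => i _; rewrite embed_mxE; congr (_ * _).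
have uE k : (A *m (embed_mx *m u)) k ord0 =
    dot (embed_mx *m u) (\col_j A k j).
  by rewrite mxE; apply: eq_bigr => j _; rewrite mxE mulrC mxE.
rewrite uE (dot_supported _ (supported_embed u)) mxE.
by apply: eq_bigr => j _; rewrite embed_mxE !mxE mulrC.
Qed.

Lemma embed_restrict (w : 'cV[R]_p) : supported I w ->
  embed_mx *m (\col_i w (enum_val i) ord0) = w.
Proof.
move=> wI; apply/matrixP => j k; have -> : k = ord0 by rewrite ord1.
have [jI|jI] := boolP (j \in I); last first.
  by rewrite wI//; apply: supported_embed.
by rewrite -(enum_rankK_in jI jI) embed_mxE mxE.
Qed.

(** Extending by zero is an isometry onto the vectors supported in [I], so the Rayleigh quotients of
    the principal submatrix are those of [A] on that subspace. *)
Lemma lambda1_principal_itv (A : 'M[R]_p) (lo hi : R) : (0 < #|I|)%N -> A^T = A ->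
  (exists w, [/\ supported I w, nsq w = 1 & lo <= bil A w w]) ->
  (forall w, supported I w -> nsq w = 1 -> bil A w w <= hi) ->
  lo <= lambda1 (principal_submx A I) <= hi.
Proof.
move=> I0 sA [w [wI w1 wlo]] whi.
have sS : (principal_submx A I)^T = principal_submx A I.
  by apply/matrixP => i j; rewrite !mxE -[in RHS]sA mxE.
have [[u [u1 uE]] h] := lambda1_rayleigh I0 sS.
apply/andP; split.
  have := h (\col_i w (enum_val i) ord0).
  rewrite principal_submxE -nsq_embed embed_restrict// w1 mulr1.
  exact: le_trans.
rewrite -uE principal_submxE; apply: whi; first exact: supported_embed.
by rewrite nsq_embed.
Qed.

End principal.

(** * Deviation of the whitened covariance *)

Section deviation.
Context {R : realType} (p : nat) (beta : R) (v : 'cV[R]_p).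
Hypotheses (beta0 : 0 <= beta) (v1 : nsq v = 1).
Implicit Types (A : 'M[R]_p) (u w : 'cV[R]_p).

Let r : R := Num.sqrt (1 + beta).

Definition whiten_mx : 'M[R]_p := 1%:M + (r^-1 - 1) *: (v *m v^T).

Definition dev_mx A : 'M[R]_p := whiten_mx^T *m A *m whiten_mx - 1%:M.

Lemma whiten_mxE u : whiten_mx *m u = u + ((r^-1 - 1) * dot v u) *: v.
Proof.
rewrite mulmxDl mul1mx -scalemxAl -mulmxA -scalerA; congr (_ + _ *: _).
apply/matrixP => i j; rewrite !mxE big_ord1 [in RHS]mulrC !ord1; congr (_ * _).
by rewrite mxE; apply: eq_bigr => k _; rewrite mxE.
Qed.

Lemma bil_dev A u w :
  bil (dev_mx A) u w = bil A (whiten_mx *m u) (whiten_mx *m w) - dot u w.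
Proof.
rewrite /bil /dev_mx mulmxBl mul1mx -scaleN1r dotDr dotZr mulN1r.
by rewrite -!mulmxA (dot_mulmx whiten_mx^T) trmxK.
Qed.

Lemma dev_mx_sym A : A^T = A -> (dev_mx A)^T = dev_mx A.
Proof. by move=> sA; rewrite linearB/= trmx1 !trmx_mul trmxK sA mulmxA. Qed.

Let r0 : 0 < r. Proof. by rewrite sqrtr_gt0 ltr_pwDl. Qed.

Let r2 : r ^+ 2 = 1 + beta. Proof. by rewrite sqr_sqrtr// addr_ge0. Qed.

(** With [a = whiten_mx *m u], the left side is [a^T K a] for the population covariance [K], that
    is, the variance of the linear form [a] of a sample. *)
Lemma var_whiten u :
  nsq (whiten_mx *m u) + beta * dot v (whiten_mx *m u) ^+ 2 = nsq u.
Proof.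
rewrite whiten_mxE nsqD nsqZ dotDr !dotZr -/(nsq v) v1 (dotC u v).
have -> : beta = r ^+ 2 - 1 by rewrite r2 addrC addKr.
by field; rewrite gt_eqF.
Qed.

(* Splitting [w = y + a v] with [y] orthogonal to [v], the preimage of [w] under
   [whiten_mx] is [y + r a v]; so [e] is only multiplied by [r], and the factor
   [1 + beta] only hits the fixed direction [v]. *)
Lemma deviation_bound A (J : {set 'I_p}) (e f : R) : A^T = A ->
  (forall u, supported J u -> nsq u <= 1 -> `|bil (dev_mx A) u u| <= e) ->
  `|bil (dev_mx A) v v| <= f -> supported J v ->
  forall w, supported J w -> nsq w = 1 ->
  `|bil A w w - (1 + beta * dot v w ^+ 2)| <= 3 * r * e + (1 + beta) * f.
Proof.
move=> sA he hf vJ w wJ w1.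
have sD := dev_mx_sym sA.
have pol := bil_polarization sD he.
have [a aE] : exists a, a = dot v w by eexists.
have a2 : a ^+ 2 <= 1 by rewrite aE (le_trans (cauchy_schwarz _ _))// v1 w1 mulr1.
have an : `|a| <= 1.
  by rewrite -(@ler_pXn2r _ 2) ?nnegrE// expr1n real_normK ?num_real.
have [y yE] : exists y, y = w + (- a) *: v by eexists.
have yJ : supported J y by rewrite yE; apply: supportedD => //; exact: supportedZ.
have y1 : nsq y = 1 - a ^+ 2.
  by rewrite yE nsqD nsqZ dotZr w1 v1 (dotC w) -aE; ring.
have vy : dot v y = 0.
  by rewrite yE dotDr dotZr -/(nsq v) v1 -aE; ring.
have [U UE] : exists U, U = y + (r * a) *: v by eexists.
have hU : whiten_mx *m U = w.
  rewrite whiten_mxE UE dotDr dotZr vy -/(nsq v) v1 yE -!addrA.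
  rewrite -!scalerDl [X in _ + X *: _](_ : _ = 0) ?scale0r ?addr0//.
  by field; rewrite gt_eqF.
have nU : nsq U = 1 + beta * a ^+ 2.
  rewrite UE nsqD nsqZ dotZr v1 (dotC y) vy y1 exprMn r2; ring.
have y1' : nsq y <= 1 by rewrite y1 gerBl sqr_ge0.
have Hyy := he y yJ y1'.
have Hyv : `|bil (dev_mx A) y v| <= e by apply: pol; rewrite ?v1.
have -> : bil A w w - (1 + beta * dot v w ^+ 2) = bil (dev_mx A) U U.
  by rewrite bil_dev hU -/(nsq U) nU aE.
have -> : bil (dev_mx A) U U = bil (dev_mx A) y y +
   (2 * r * a) * bil (dev_mx A) y v + ((1 + beta) * a ^+ 2) * bil (dev_mx A) v v.
  rewrite UE !(bilDl, bilDr, bilZl, bilZr) (bilC v y sD) -r2; ring.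
have e0 : 0 <= e by apply: le_trans Hyy.
have r1 : 1 <= r by rewrite -(@ler_pXn2r _ 2) ?nnegrE ?(ltW r0)// expr1n r2 lerDl.
rewrite (le_trans (ler_normD _ _))// lerD//.
  rewrite (le_trans (ler_normD _ _))//.
  (* The constant 3: the term in [(y, y)], at most [e], is enlarged to [r e] by [1 <= r], and the
     cross term contributes [2 r e]. *)
  rewrite (_ : 3 * r * e = r * e + 2 * r * e); last by ring.
  rewrite lerD//.
    by rewrite (le_trans Hyy)// ler_peMl.
  rewrite !normrM (ger0_norm (ltW r0)) normr_nat.
  have r2_0 : 0 <= 2 * r by rewrite mulr_ge0// ltW.
  by apply: ler_pM => //; [exact: mulr_ge0|exact: ler_piMr].
have b0 : 0 <= 1 + beta by rewrite addr_ge0.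
have ba : 0 <= (1 + beta) * a ^+ 2 by apply: mulr_ge0 => //; exact: sqr_ge0.
rewrite normrM (ger0_norm ba).
by apply: ler_pM => //; exact: ler_piMr.
Qed.

Variable k : nat.
Hypotheses (k0 : (0 < k)%N) (vk : uniform_spike k v).

(** Each common index of [I] and the support contributes [1 / k]. The vector is the orthogonal
    projection of [v] on the vectors supported in [I], so [delta] is the largest value of
    [dot v w ^+ 2] over unit [w] supported in [I]. *)
Lemma spike_overlap (I : {set 'I_p}) (delta : R) :
  #|I :&: vsupport v|%:R = delta * k%:R ->
  nsq (\col_j (if j \in I then v j ord0 else 0)) = delta.
Proof.
move=> hd; have [_ _ hv] := vk.
have kR : (0 : R) < k%:R by rewrite ltr0n.
rewrite /nsq /dot (bigID (mem (I :&: vsupport v)))/= [X in _ + X]big1; last first.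
  move=> j; rewrite !inE mxE; case: (j \in I) => /=; last by rewrite mul0r.
  by rewrite negbK => /eqP ->; rewrite mul0r.
rewrite addr0 (eq_bigr (fun=> k%:R^-1)); last first.
  move=> j; rewrite inE => /andP[jI jS]; rewrite mxE jI hv//.
  by rewrite mul1r -expr2 exprVn sqr_sqrtr// ler0n.
by rewrite sumr_const -(mulr_natl _ #|_|) hd mulfK// gt_eqF.
Qed.

(** On unit vectors supported in [I] the population form is [1 + beta * dot v w ^+ 2].
    Cauchy-Schwarz bounds it by [1 + delta * beta], and the normalised restriction of [v] reaches
    this value. The sets are enlarged by the support of [v] because un-whitening adds a multiple of
    [v]. *)
Lemma lambda1_deviation A (e f G : R) : A^T = A ->
  (forall I : {set 'I_p}, #|I| = k ->
    forall u, supported (I :|: vsupport v) u -> nsq u <= 1 ->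
      `|bil (dev_mx A) u u| <= e) ->
  `|bil (dev_mx A) v v| <= f ->
  3 * r * e + (1 + beta) * f <= G ->
  forall (delta : R) (I : {set 'I_p}), #|I| = k ->
    #|I :&: vsupport v|%:R = delta * k%:R ->
    lambda1 (principal_submx A I) \in
      `[1 + delta * beta - G, 1 + delta * beta + G + beta / k%:R].
Proof.
move=> sA he hf hG delta I Ik hd.
have vIn := spike_overlap hd.
set vI := \col_j _ in vIn.
have kR : (0 : R) < k%:R by rewrite ltr0n.
have d0 : 0 <= delta by rewrite -vIn nsq_ge0.
have dotI w : supported I w -> dot v w = dot vI w.
  move=> wI; apply: eq_bigr => j _; rewrite mxE; case: ifPn => // jI.
  by rewrite wI// !mulr0.
have D w : supported I w -> nsq w = 1 ->
    `|bil A w w - (1 + beta * dot v w ^+ 2)| <= G.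
  move=> wI w1; apply: le_trans hG.
  apply: (deviation_bound sA (he I Ik) hf) => //.
    move=> j; rewrite !inE negb_or => /andP[_]; rewrite negbK => /eqP //.
  by move=> j; rewrite inE negb_or => /andP[jI _]; exact: wI.
rewrite in_itv/=; apply: lambda1_principal_itv => //; first by rewrite Ik.
- have [w [wI w1 wd]] : exists w, [/\ supported I w, nsq w = 1 &
      delta <= dot v w ^+ 2].
    (* For [delta = 0] the restriction of [v] to [I] is null and cannot be normalised; any basis
       vector of [I] serves instead. *)
    have [dz|dz] := eqVneq delta 0.
      have /card_gt0P[j jI] : (0 < #|I|)%N by rewrite Ik.
      exists (\col_i (i == j)%:R); split.
      - by move=> i iI; rewrite mxE; case: eqP => // ij; rewrite ij jI in iI.
      - rewrite /nsq /dot (bigD1 j)//= big1 ?addr0.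
          by rewrite !mxE eqxx mulr1.
        by move=> i ij; rewrite !mxE (negbTE ij) mulr0.
      - by rewrite dz sqr_ge0.
    have vI0 : nsq vI != 0 by rewrite vIn.
    have [w1 wE] := normalize vI0.
    have sI : supported I vI by move=> j jI; rewrite mxE (negbTE jI).
    exists ((Num.sqrt (nsq vI))^-1 *: vI); split => //; first exact: supportedZ.
    rewrite dotI; last exact: supportedZ.
    rewrite dotZr -/(nsq vI) exprMn exprVn sqr_sqrtr ?nsq_ge0// vIn.
    by rewrite expr2 mulrA mulVf// mul1r.
  exists w; split => //; have := D w wI w1.
  rewrite ler_norml => /andP[h _].
  have h2 : beta * delta <= beta * dot v w ^+ 2 by rewrite ler_wpM2l.
  rewrite (mulrC delta); lra.
- move=> w wI w1; have := D w wI w1; rewrite ler_norml => /andP[_ h].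
  have h1 : dot v w ^+ 2 <= delta.
    by rewrite dotI// (le_trans (cauchy_schwarz _ _))// w1 vIn mulr1.
  have h2 : beta * dot v w ^+ 2 <= beta * delta by rewrite ler_wpM2l.
  have h3 : 0 <= beta / k%:R by rewrite divr_ge0// ltW.
  rewrite (mulrC delta); lra.
Qed.

End deviation.

(** * Lattice nets of Euclidean balls, with exponentially many points in the dimension *)

Section net.
Context {R : realType} (p q : nat) (J : {set 'I_p}).
Hypotheses (q0 : (0 < q)%N) (Jq : (#|J| <= q)%N).

Notation code := (bool * 'I_(16 * q).+1)%type.

(** Codes for points of a lattice of mesh [1 / h], [h = 4 sqrt q]: a sign and an integer magnitude
    per coordinate, with [(false, ord0)] forced outside [J]. The budget [16 q = h^2] bounds the sum
    of the magnitudes, not of their squares, so that a geometric weight can count the codes.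
    Counting each coordinate separately would add a factor of order [ln q] in the exponent. *)
Definition grid_codes : {set {ffun 'I_p -> code}} :=
  [set g : {ffun 'I_p -> code} | [forall j, (j \notin J) ==> (g j == (false, ord0))] &
           (\sum_(j in J) (g j).2 <= 16 * q)%N]%SET.

Lemma sum_half_pow N : \sum_(m < N) 2^-1 ^+ m <= 2 :> R.
Proof.
rewrite (_ : \sum_(m < N) _ = 2 - 2 * 2^-1 ^+ N :> R); last first.
  elim: N => [|N IH]; first by rewrite big_ord0 expr0; ring.
  by rewrite big_ord_recr/= IH exprS; field.
by rewrite gerBl mulr_ge0// exprn_ge0.
Qed.

(* Every code of total size at most [16 q] has weight at least [2 ^- (16 q)]
   in a product of [#|J|] sums, each at most 4. *)
Lemma card_grid_codes : (#|grid_codes| <= 2 ^ (18 * q))%N.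
Proof.
pose F (j : 'I_p) (x : code) : R :=
  if j \in J then 2^-1 ^+ x.2 else (x == (false, ord0))%:R.
have F0 j x : 0 <= F j x.
  by rewrite /F; case: ifP => _; rewrite ?exprn_ge0.
have lower (g : {ffun 'I_p -> code}) : g \in grid_codes ->
    2^-1 ^+ (16 * q) <= \prod_j F j (g j).
  rewrite inE => /andP[/forallP g0 gs].
  rewrite (bigID (mem J))/= [X in _ * X]big1 ?mulr1; last first.
    by move=> j jJ; rewrite /F (negbTE jJ) (eqP (implyP (g0 j) jJ)) eqxx.
  rewrite (eq_bigr (fun j => 2^-1 ^+ (g j).2)); last by move=> j; rewrite /F => ->.
  by rewrite prodrXr ler_wiXn2l// invf_le1// ler1n.
have upper : \sum_(g : {ffun 'I_p -> code}) \prod_j F j (g j) <= 4 ^+ q.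
  rewrite -bigA_distr_bigA/=.
  apply: (@le_trans _ _ (\prod_(j < p) (if j \in J then 4 else 1))).
    apply: ler_prod => j _; rewrite sumr_ge0//=.
    rewrite /F; case: ifP => jJ; last first.
      rewrite (bigD1 (false, ord0))// eqxx big1; last by move=> x /negbTE ->.
      by rewrite /= addr0.
    rewrite -(pair_big xpredT xpredT 
      (fun (b : bool) (m : 'I_(16 * q).+1) => 2^-1 ^+ m : R))/=.
    rewrite big_bool/=; have := sum_half_pow (16 * q).+1; lra.
  rewrite -big_mkcond prodr_const; apply: ler_weXn2l => //.
  by rewrite ler1n.
have : #|grid_codes|%:R * 2^-1 ^+ (16 * q) <= 4 ^+ q :> R.
  apply: le_trans upper.
  rewrite mulr_natl -sumr_const; apply: (@le_trans _ _
      (\sum_(g : {ffun 'I_p -> code} | g \in grid_codes) \prod_j F j (g j))).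
    by apply: ler_sum => g /lower.
  rewrite [leRHS](bigID (mem grid_codes))/= lerDl.
  by apply: sumr_ge0 => g _; apply: prodr_ge0 => j _; exact: F0.
rewrite exprVn ler_pdivrMr ?exprn_gt0//.
rewrite (_ : 4 = 2 ^+ 2 :> R); last by rewrite expr2; ring.
by rewrite -exprM -exprD -natrX ler_nat -mulnDl.
Qed.

(** Each coordinate of [h u] is truncated towards zero. This keeps the support and does not increase
    the norm, and the error is at most [1 / h] on each of at most [q] coordinates, hence at most
    [q / h^2 = 1 / 16] in squared norm. *)
Lemma net_exists : exists s : seq 'cV[R]_p, (size s <= 2 ^ (18 * q))%N /\
  forall u, supported J u -> nsq u <= 1 -> exists z,
    [/\ z \in s, supported J z, nsq z <= 1 & nsq (u - z) <= 16^-1].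
Proof.
pose h : R := 4 * Num.sqrt q%:R.
have qR : (0 : R) < q%:R by rewrite ltr0n.
have h0 : 0 < h by rewrite mulr_gt0// sqrtr_gt0.
have h2 : h ^+ 2 = (16 * q)%:R.
  by rewrite exprMn sqr_sqrtr ?ler0n// natrM; congr (_ * _); ring.
pose pt (g : {ffun 'I_p -> code}) : 'cV[R]_p :=
  \col_j ((-1) ^+ (g j).1 * (g j).2%:R / h).
exists [seq pt g | g <- enum grid_codes]; split.
  by rewrite size_map -cardE card_grid_codes.
move=> u uJ u1.
pose m j := Num.truncn (h * `|u j ord0|).
have mle j : (m j)%:R <= h * `|u j ord0|.
  by rewrite truncn_le// mulr_ge0// ltW.
have mgt j : h * `|u j ord0| < (m j).+1%:R by exact: truncnS_gt.
have msum : \sum_j (m j)%:R ^+ 2 <= (16 * q)%:R :> R.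
  apply: (@le_trans _ _ (\sum_j h ^+ 2 * (u j ord0 * u j ord0))).
    apply: ler_sum => j _.
    rewrite -expr2 -(real_normK (num_real (u j ord0))) -exprMn.
    by rewrite ler_pXn2r ?nnegrE ?mulr_ge0 ?(ltW h0).
  by rewrite -mulr_sumr h2 ler_piMr ?ler0n.
(* For a natural number [m <= m^2], so the bound on the squares also bounds the sum. *)
have msumN : (\sum_j m j <= 16 * q)%N.
  rewrite -(ler_nat R); apply: le_trans msum.
  rewrite natr_sum; apply: ler_sum => j _.
  by rewrite -natrX ler_nat; case: (m j) => // n; rewrite expnS leq_pmulr// expn_gt0.
have mlt j : (m j < (16 * q).+1)%N.
  by rewrite ltnS (leq_trans _ msumN)// (bigD1 j)//= leq_addr.
pose g : {ffun 'I_p -> code} := [ffun j => (u j ord0 < 0, Ordinal (mlt j))].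
have m0 j : j \notin J -> m j = 0%N.
  by move=> jJ; rewrite /m uJ// normr0 mulr0 truncn0.
have ptE j : pt g j ord0 = (-1) ^+ (u j ord0 < 0)%R * (m j)%:R / h.
  by rewrite mxE ffunE.
exists (pt g); split.
- apply: map_f; rewrite mem_enum inE; apply/andP; split.
    apply/forallP => j; apply/implyP => jJ; rewrite ffunE uJ// ltxx.
    by rewrite xpair_eqE eqxx/=; apply/eqP/val_inj; rewrite /= m0.
  apply: leq_trans msumN.
  rewrite [leqRHS](bigID (mem J))/= (leq_trans _ (leq_addr _ _))//.
  by apply: leq_sum => j _; rewrite ffunE.
- by move=> j jJ; rewrite ptE m0// mulr0 mul0r.
- rewrite /nsq /dot.
  apply: le_trans u1; apply: ler_sum => j _; rewrite ptE -!expr2.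
  rewrite !exprMn sqrr_sign mul1r exprVn ler_pdivrMr ?exprn_gt0//.
  rewrite -(real_normK (num_real (u j ord0))) -exprMn mulrC.
  by rewrite ler_pXn2r ?nnegrE ?mulr_ge0 ?(ltW h0).
- apply: (@le_trans _ _ (\sum_(j in J) (h ^+ 2)^-1)); last first.
    rewrite sumr_const h2 natrM -(mulr_natl _ #|J|) invfM mulrCA ler_piMr//.
    by rewrite ler_pdivrMr// mul1r ler_nat.
  rewrite /nsq /dot (bigID (mem J))/= [X in _ + X]big1 ?addr0; last first.
    by move=> j jJ; rewrite mxE mxE uJ// ptE m0// mulr0 mul0r subr0 mulr0.
  apply: ler_sum => j _; rewrite mxE mxE ptE -expr2.
  have -> : u j ord0 - (-1) ^+ (u j ord0 < 0)%R * (m j)%:R / h =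
      (-1) ^+ (u j ord0 < 0)%R * (`|u j ord0| - (m j)%:R / h).
    rewrite mulrBr mulrA; congr (_ - _).
    exact: numEsign.
  have hu0 : 0 <= `|u j ord0| - (m j)%:R / h by rewrite subr_ge0 ler_pdivrMr// mulrC.
  rewrite exprMn sqrr_sign mul1r -exprVn ler_pXn2r ?nnegrE ?invr_ge0 ?(ltW h0)//.
  rewrite lerBlDr -[X in X + _]mul1r -mulrDl ler_pdivlMr// mulrC.
  by rewrite addrC natr1 ltW.
Qed.

End net.

(** * Concentration of chi-square averages *)

Section simple_functions.

Import HBNNSimple.

(** Indexing the values by an ordinal makes a product of such sums expandable by finite
    distributivity. *)
Lemma nnsfun_sum (R : realType) d (T : measurableType d) (h : {nnsfun T >-> R}) :
  exists N (c : 'I_N -> R) (B : 'I_N -> set T),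
    [/\ forall j, 0 <= c j, forall j, measurable (B j) &
        forall x, h x = \sum_(j < N) c j * \1_(B j) x].
Proof.
pose s := finmap.enum_fset (fset_set (range h)).
exists (size s), (fun j => s`_j), (fun j => h @^-1` [set s`_j]); split.
- move=> j; have : s`_j \in s by exact: mem_nth.
  rewrite /s in_fset_set; last exact: (@fimfunP _ _ h).
  by rewrite inE => -[x _ <-].
- by move=> j; exact: measurable_sfunP.
- move=> x; rewrite {1}fimfunE fsbig_finite//= (big_nth 0) big_mkord.
  by apply: eq_bigr.
Qed.

Lemma integral_nnsfun_sum (R : realType) d (T : measurableType d)
    (mu : {measure set T -> \bar R}) (I : finType) (c : I -> R)
    (B : I -> set T) :
  (forall j, 0 <= c j) -> (forall j, measurable (B j)) ->
  (\int[mu]_x (\sum_j c j * \1_(B j) x)%R%:E = \sum_j (c j)%:E * mu (B j))%E.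
Proof.
move=> c0 mB.
under eq_integral do rewrite -sumEFin.
rewrite ge0_integral_sum//=.
- apply: eq_bigr => j _; under eq_integral do rewrite EFinM.
  rewrite ge0_integralZl//=; last by rewrite lee_fin.
    by rewrite integral_indic// setIT.
  by apply/measurable_EFinP; exact: measurable_indic.
- move=> j; apply/measurable_EFinP.
  by apply: measurable_funM => //; exact: measurable_indic.
- by move=> j x _; rewrite lee_fin mulr_ge0// indicE.
Qed.

End simple_functions.

Section product.

Import HBNNSimple.

Context {R : realType} {d : measure_display} {T : measurableType d}.
Variables (P : probability T R) (d' : measure_display) (T' : measurableType d').
Variables (nu : probability T' R).
Variables (I : finType) (Y : I -> T -> T').
Hypothesis mY : forall i, measurable_fun setT (Y i).
Hypothesis indY : forall B : I -> set T', (forall i, measurable (B i)) ->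
  P [set w | forall i, B i (Y i w)] = (\big[mule/1]_i nu (B i))%E.

(** Expanding the product gives a sum over maps [phi] from [I] to the values of [h]. Each term is a
    multiple of the indicator of a joint event, whose probability factors by [indY]; the factored
    sum then collapses to a power of the single integral. *)
Lemma integral_prod_nnsfun (h : {nnsfun T' >-> R}) (M : R) :
  (\int[nu]_x (h x)%:E <= M%:E)%E ->
  (\int[P]_w (\prod_i h (Y i w))%:E <= (M ^+ #|I|)%:E)%E.
Proof.
have [N [c [B [c0 mB hE]]]] := nnsfun_sum h.
have -> : (\int[nu]_x (h x)%:E =
    (\sum_j c j * fine (nu (B j)))%:E)%E.
  under eq_integral do rewrite hE.
  rewrite integral_nnsfun_sum// -sumEFin; apply: eq_bigr => j _.
  by rewrite EFinM fineK// fin_num_measure.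
rewrite lee_fin => hM.
pose E (phi : {ffun I -> 'I_N}) := [set w | forall i, B (phi i) (Y i w)].
have mE phi : measurable (E phi).
  rewrite (_ : E phi = \big[setI/setT]_i (Y i @^-1` B (phi i))).
    by apply: bigsetI_measurable => i _; rewrite -[X in measurable X]setTI; exact: mY.
  rewrite -bigcap_seq /E; apply/seteqP; split => w /= Hw.
    by move=> i _; exact: Hw.
  by move=> i; apply: Hw; rewrite /= mem_index_enum.
have -> : (\int[P]_w (\prod_i h (Y i w))%:E =
    \int[P]_w (\sum_(phi : {ffun I -> 'I_N}) (\prod_i c (phi i)) * \1_(E phi) w)%:E)%E.
  apply: eq_integral => w _; congr (_%:E).
  under eq_bigr do rewrite hE.
  rewrite bigA_distr_bigA/=; apply: eq_bigr => phi _.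
  rewrite big_split/=; congr (_ * _).
  have [Hw|Hw] := pselect (E phi w).
    rewrite [in RHS]indicE mem_set//= big1// => i _.
    by rewrite indicE mem_set.
  rewrite [in RHS]indicE memNset//=.
  move/existsNP : Hw => [i Hi].
  by rewrite (bigD1 i)//= indicE memNset// mul0r.
rewrite integral_nnsfun_sum//; last by move=> phi; apply: prodr_ge0.
have PE phi : P (E phi) = (\prod_i fine (nu (B (phi i))))%:E.
  rewrite /E (indY (fun i => mB (phi i))) -prodEFin.
  by apply: eq_bigr => i _; rewrite fineK// fin_num_measure.
rewrite (eq_bigr (fun phi : {ffun I -> 'I_N} =>
  (\prod_i (c (phi i) * fine (nu (B (phi i)))))%:E)); last first.
  by move=> phi _; rewrite big_split/= EFinM -PE.
rewrite sumEFin -(bigA_distr_bigA (fun i j => c j * fine (nu (B j))))/= lee_fin.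
rewrite prodr_const; apply: lerXn2r => //; rewrite nnegrE.
  by apply: sumr_ge0 => j _; rewrite mulr_ge0// fine_ge0.
apply: le_trans hM.
by apply: sumr_ge0 => j _; rewrite mulr_ge0// fine_ge0.
Qed.

(** Monotone convergence along simple approximations of [f]. Independence is known on product sets
    only, and this route avoids building a product measure. *)
Lemma integral_prod_le (f : T' -> R) (M : R) :
  measurable_fun setT f -> (forall x, 0 <= f x) ->
  (\int[nu]_x (f x)%:E <= M%:E)%E ->
  (\int[P]_w (\prod_i f (Y i w))%:E <= (M ^+ #|I|)%:E)%E.
Proof.
move=> mf f0 fM.
have mf' : measurable_fun setT (EFin \o f) by exact/measurable_EFinP.
pose h := nnsfun_approx measurableT mf'.
have hcv x : h ^~ x @ \oo --> f x.
  have f0' x' : setT x' -> (0%E <= (EFin \o f) x')%E by rewrite /= lee_fin.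
  have := @cvg_nnsfun_approx _ _ _ _ measurableT _ mf' f0' x Logic.I.
  by move/fine_cvgP => [].
have hnd x : nondecreasing_seq (h ^~ x).
  by move=> m n mn; exact/lefP/nd_nnsfun_approx.
have hf n x : h n x <= f x.
  rewrite -(cvg_lim _ (hcv x))//.
  by apply: nondecreasing_cvgn_le; [exact: hnd|exact: cvgP (hcv x)].
have hM n : (\int[P]_w (\prod_i h n (Y i w))%:E <= (M ^+ #|I|)%:E)%E.
  apply: integral_prod_nnsfun; apply: le_trans fM.
  apply: ge0_le_integral => //=.
  - by move=> x _; rewrite lee_fin.
  - by apply/measurable_EFinP; exact: measurable_funP.
  - by move=> x _; rewrite lee_fin.
have mp n : measurable_fun setT (fun w => (\prod_i h n (Y i w))%:E).
  apply/measurable_EFinP; apply: measurable_prod => i _.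
  by apply: measurableT_comp => //; exact: measurable_funP.
have := @cvg_monotone_convergence _ _ _ P setT measurableT
  (fun n w => (\prod_i h n (Y i w))%:E) mp.
have p0 n w : setT w -> (0 <= (\prod_i h n (Y i w))%:E)%E.
  by rewrite lee_fin prodr_ge0.
have pnd w : setT w -> nondecreasing_seq (fun n => (\prod_i h n (Y i w))%:E).
  by move=> _ m n mn; rewrite lee_fin; apply: ler_prod => i _; rewrite hnd// andbT.
move=> /(_ p0 pnd) Hc.
rewrite (_ : (\int[P]_w (\prod_i f (Y i w))%:E =
  \int[P]_w lim ((\prod_i h n (Y i w))%:E @[n --> \oo]))%E); last first.
  apply: eq_integral => w _; apply/esym/cvg_lim => //.
  apply: cvg_EFin; first exact: nearW.
  rewrite /= (_ : _ \o _ = fun n => \prod_i h n (Y i w)); last by [].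
  by apply: (cvg_big (@mul_continuous R)) => i _; exact: hcv.
rewrite -(cvg_lim _ Hc)//.
apply: lime_le; last exact: nearW.
by apply/cvg_ex; eexists; exact: Hc.
Qed.

End product.

Section gaussian.

Import HBNNSimple.

Lemma integral_normal_prob_le (R : realType) (m s : R) (f : R -> R) :
  measurable_fun setT f -> (forall x, 0 <= f x) ->
  (\int[normal_prob m s]_x (f x)%:E <=
   \int[lebesgue_measure]_x (f x * normal_pdf m s x)%:E)%E.
Proof.
move=> mf f0; rewrite ge0_integralTE//=.
apply: ge_ereal_sup => _ [h /= hf <-].
rewrite -integralT_nnsfun.
have [N [c [B [c0 mB hE]]]] := nnsfun_sum h.
under eq_integral do rewrite /= hE.
rewrite integral_nnsfun_sum//.
have mn := measurable_normal_pdf m s.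
have n0 := @normal_pdf_ge0 R m s.
apply: (@le_trans _ _ (\int[lebesgue_measure]_x (h x * normal_pdf m s x)%:E)%E).
  rewrite le_eqVlt; apply/orP; left; apply/eqP.
  under [RHS]eq_integral do rewrite hE mulr_suml -sumEFin.
  rewrite ge0_integral_sum//=.
  - apply: eq_bigr => j _.
    under eq_integral do rewrite -mulrA EFinM.
    rewrite ge0_integralZl//=.
    + rewrite /normal_prob integral_mkcond; congr (_ * _)%E.
      apply: eq_integral => x _.
      by rewrite epatch_indic EFinM muleC.
    + by apply/measurable_EFinP; apply: measurable_funM.
    + by move=> x _; rewrite lee_fin mulr_ge0// indicE.
    + by rewrite lee_fin.
  - move=> j; apply/measurable_EFinP; apply: measurable_funM => //.
    by apply: measurable_funM.
  - by move=> j x _; rewrite lee_fin !mulr_ge0// indicE.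
apply: ge0_le_integral => //=.
- by move=> x _; rewrite lee_fin mulr_ge0.
- by apply/measurable_EFinP; apply: measurable_funM => //; exact: measurable_funP.
- by apply/measurable_EFinP; apply: measurable_funM.
- by move=> x _; rewrite lee_fin ler_wpM2r// -lee_fin; exact: hf.
Qed.

(** The integrand times the standard density is [s] times the density of deviation
    [s = (1 - 2 l)^(-1/2)], which has mass 1. *)
Lemma integral_expR_sqr_normal (R : realType) (l : R) : l < 2^-1 ->
  (\int[normal_prob 0 1]_x (expR (l * x ^+ 2))%:E <=
   (Num.sqrt (1 - 2 * l))^-1%:E)%E.
Proof.
move=> l2.
have D0 : 0 < 1 - 2 * l by lra.
set s := (Num.sqrt (1 - 2 * l))^-1.
have s0 : 0 < s by rewrite invr_gt0 sqrtr_gt0.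
have mf : measurable_fun setT (fun x : R => expR (l * x ^+ 2)).
  apply: measurableT_comp => //; apply: measurable_funM => //.
apply: le_trans (integral_normal_prob_le 0 1 mf _) _; first by move=> x; exact: expR_ge0.
have E x : expR (l * x ^+ 2) * normal_pdf 0 1 x = s * normal_pdf 0 s x.
  rewrite !normal_pdfE ?oner_neq0 ?gt_eqF//.
  rewrite /normal_peak /normal_fun !subr0.
  rewrite mulrCA -expRD mulrA; congr (_ * expR _).
    rewrite expr1n -!mulrnAr mul1r (sqrtrM _ (sqr_ge0 s)) sqrtr_sqr gtr0_norm//.
    by rewrite invfM mulrA divff ?mul1r// gt_eqF.
  have -> : s ^+ 2 = (1 - 2 * l)^-1 by rewrite /s exprVn sqr_sqrtr// ltW.
  rewrite expr1n -(mulr_natr _ 2) -(mulr_natr _^-1 2) mul1r invfM invrK.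
  by field.
under eq_integral do rewrite E EFinM.
rewrite ge0_integralZl//=.
- by rewrite integral_normal_pdf mule1.
- by apply/measurable_EFinP; exact: measurable_normal_pdf.
- by move=> x _; rewrite lee_fin normal_pdf_ge0.
- by rewrite lee_fin ltW.
Qed.

(** By [1 + y <= exp y] it suffices that [(1 + l + 2 l^2)^2 (1 - 2 l) >= 1]. The difference is [l^2]
    times a cubic that is positive for [|l| <= 1/8]. *)
Lemma invsqrt_le_expR (R : realType) (l : R) : `|l| <= 8^-1 ->
  (Num.sqrt (1 - 2 * l))^-1 <= expR (l + 2 * l ^+ 2).
Proof.
rewrite ler_norml => /andP[l1 l2].
have D0 : 0 < 1 - 2 * l by lra.
rewrite -[leLHS]mul1r ler_pdivrMr ?sqrtr_gt0//.
have e0 := expR_ge0 (l + 2 * l ^+ 2).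
rewrite -(ger0_norm e0) -sqrtr_sqr -sqrtrM ?sqr_ge0//.
rewrite -[leLHS](@sqrtr1 R) ler_wsqrtr//.
have h1 := expR_ge1Dx (l + 2 * l ^+ 2).
have h2 : (1 + (l + 2 * l ^+ 2)) ^+ 2 <= expR (l + 2 * l ^+ 2) ^+ 2.
  have ? := sqr_ge0 l.
  by rewrite lerXn2r// ?nnegrE//; lra.
apply: (@le_trans _ _ ((1 + (l + 2 * l ^+ 2)) ^+ 2 * (1 - 2 * l))).
  rewrite -subr_ge0.
  rewrite (_ : _ - _ = l ^+ 2 * (1 - 6 * l - 4 * l ^+ 2 - 8 * l ^+ 3)); last by ring.
  apply: mulr_ge0; first exact: sqr_ge0.
  have l3 : l * l ^+ 2 <= 8^-1 * l ^+ 2 by rewrite ler_wpM2r ?sqr_ge0.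
  have l4 : 0 <= (8^-1 - l) * (8^-1 + l) by rewrite mulr_ge0//; lra.
  have l5 : (8^-1 - l) * (8^-1 + l) = 64^-1 - l ^+ 2 by field.
  rewrite exprS; lra.
by rewrite ler_wpM2r// ltW.
Qed.

End gaussian.

Section chi2.
Context {R : realType} {d : measure_display} {T : measurableType d}.
Variables (P : probability T R) (n : nat) (Y : 'I_n -> T -> R).
Hypothesis mY : forall i, measurable_fun setT (Y i).
Hypothesis indY : forall B : 'I_n -> set R, (forall i, measurable (B i)) ->
  P [set w | forall i, B i (Y i w)] = (\big[mule/1]_i normal_prob 0 1 (B i))%E.

Lemma measurable_sum_sqr : measurable_fun setT (fun w => \sum_i Y i w ^+ 2).
Proof.
apply: measurable_sum => i; exact: measurable_funX.
Qed.

(** Markov's inequality for the exponential moment. The sign of [l] is free, so that one statement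
    covers both tails. *)
Lemma chi2_chernoff (l a : R) : `|l| <= 8^-1 ->
  (P [set w | a <= l * \sum_i Y i w ^+ 2]%R <=
   (expR (n%:R * (l + 2 * l ^+ 2) - a))%:E)%E.
Proof.
move=> hl; set A := [set w | _].
have mS := measurable_sum_sqr.
have mA : measurable A.
  rewrite (_ : A = (fun w => l * \sum_i Y i w ^+ 2) @^-1` `[a, +oo[).
    rewrite -[X in measurable X]setTI.
    by apply: (measurable_funM (measurable_cst l) mS) => //; exact: measurable_itv.
  by apply/seteqP; split=> w /=; rewrite in_itv/= andbT.
have mf : measurable_fun setT (fun x : R => expR (l * x ^+ 2)).
  by apply: measurableT_comp => //; apply: measurable_funM.
have M1 : (\int[normal_prob 0 1]_x (expR (l * x ^+ 2))%:E <=
   (expR (l + 2 * l ^+ 2))%:E)%E.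
  apply: le_trans (integral_expR_sqr_normal _) _.
    by move: hl; rewrite ler_norml => /andP[? ?]; lra.
  by rewrite lee_fin invsqrt_le_expR.
have := @integral_prod_le R d T P _ _ (normal_prob 0 1) _ Y mY indY _ _ mf
   (fun x => expR_ge0 _) M1.
rewrite card_ord -expRM_natl.
have -> : (\int[P]_w (\prod_i expR (l * Y i w ^+ 2))%:E =
   \int[P]_w (expR (l * \sum_i Y i w ^+ 2))%:E)%E.
  by apply: eq_integral => w _; rewrite mulr_sumr expR_sum.
move=> HE.
have : (\int[P]_w (expR a * \1_A w)%:E <= (expR (n%:R * (l + 2 * l ^+ 2)))%:E)%E.
  apply: le_trans HE; apply: ge0_le_integral => //=.
  - by apply/measurable_EFinP; apply: measurable_funM.
  - apply/measurable_EFinP; apply: measurableT_comp => //.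
    exact: measurable_funM.
  - move=> w _; rewrite lee_fin indicE; have [|] := boolP (w \in A).
      by rewrite inE mulr1 ler_expR.
    by rewrite mulr0 expR_ge0.
have -> : (\int[P]_w (expR a * \1_A w)%:E = (expR a)%:E * P A)%E.
  under eq_integral do rewrite EFinM.
  rewrite ge0_integralZl//=.
  - by rewrite integral_indic// setIT.
  - exact/measurable_EFinP.
move=> H.
by rewrite expRB EFinM lee_pdivlMr ?expR_gt0// muleC.
Qed.

Lemma chi2_tail (s : R) : 0 < s -> (0 < n)%N ->
  (P [set w | s <= `| n%:R^-1 * (\sum_i Y i w ^+ 2) - 1 |]%R <=
   (2 * expR (- (n%:R * (s * Num.min s 1) / 16)))%:E)%E.
Proof.
move=> s0 n0.
have mS := measurable_sum_sqr.
have nR : (0 : R) < n%:R by rewrite ltr0n.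
(* The minimum with 1 keeps [l] in the range of the moment bound. Both tails then have exponent
   [n l (2 l - s)], and [2 l <= s / 2] makes it at most [- n l s / 2 = - n s min(s, 1) / 16]. *)
set l := Num.min s 1 / 8.
have l0 : 0 < l by rewrite divr_gt0// lt_min s0 ltr01.
have hl : `|l| <= 8^-1.
  by rewrite gtr0_norm// /l ler_pdivrMr// mulVf// ge_min lexx orbT.
have hl' : `|- l| <= 8^-1 by rewrite normrN.
have m1 : Num.min s 1 <= 1 by rewrite ge_min lexx orbT.
have ms : Num.min s 1 <= s by rewrite ge_min lexx.
have m0 : 0 < Num.min s 1 by rewrite lt_min s0 ltr01.
pose A := [set w | n%:R * (l * (1 + s)) <= l * \sum_i Y i w ^+ 2].
pose B := [set w | - (n%:R * (l * (1 - s))) <= - l * \sum_i Y i w ^+ 2].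
have mhalf (a b : R) : measurable [set w | a <= b * \sum_i Y i w ^+ 2].
  rewrite (_ : mkset _ = (fun w => b * \sum_i Y i w ^+ 2) @^-1` `[a, +oo[).
    rewrite -[X in measurable X]setTI.
    by apply: (measurable_funM (measurable_cst b) mS) => //; exact: measurable_itv.
  by apply/seteqP; split=> w /=; rewrite in_itv/= andbT.
have bnd (a : R) : a <= - (n%:R * (s * Num.min s 1) / 16) ->
  (expR a <= expR (- (n%:R * (s * Num.min s 1) / 16))) by rewrite ler_expR.
have PA := chi2_chernoff (n%:R * (l * (1 + s))) hl.
have PB := chi2_chernoff (- (n%:R * (l * (1 - s)))) hl'.
have key : n%:R * (l * (2 * l - s)) <= - (n%:R * (s * Num.min s 1) / 16).
  rewrite [leRHS](_ : _ = n%:R * (l * (- (s / 2)))); last by rewrite /l; field.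
  by rewrite !ler_pM2l// /l; lra.
rewrite mulr_natl mulr2n EFinD.
apply: (@le_trans _ _ (P (A `|` B))).
  apply: le_measure; rewrite ?inE.
  - rewrite -[X in measurable X]setTI.
    have mg : measurable_fun setT
        (fun w => `| n%:R^-1 * (\sum_i Y i w ^+ 2) - 1 |).
      apply: measurableT_comp => //; apply: measurable_funB => //.
      exact: measurable_funM.
    rewrite (_ : mkset _ = (fun w => `| n%:R^-1 * (\sum_i Y i w ^+ 2) - 1 |) @^-1`
        `[s, +oo[); first by apply: mg => //; exact: measurable_itv.
    by apply/seteqP; split=> w /=; rewrite in_itv/= andbT.
  - by apply: measurableU; exact: mhalf.
  - move=> w /=; set S := \sum_i _; rewrite ler_normr => /orP[] h; [left|right].
      rewrite /A/= -/S mulrCA ler_pM2l// -ler_pdivlMl//; lra.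
    rewrite /B/= -/S mulrCA mulNr lerN2 ler_pM2l// -ler_pdivrMl//; lra.
apply: le_trans (measureU2 _ _ _) _; [exact: mhalf|exact: mhalf|].
apply: leeD.
  apply: le_trans PA _; rewrite lee_fin; apply: bnd.
  rewrite (_ : _ - _ = n%:R * (l * (2 * l - s))); last by ring.
  exact: key.
apply: le_trans PB _; rewrite lee_fin; apply: bnd.
rewrite (_ : _ - _ = n%:R * (l * (2 * l - s))); last by ring.
exact: key.
Qed.

End chi2.

(** * The spiked model *)

Section measurability.
Context {R : realType} {d : measure_display} {T : measurableType d}.

Lemma measurable_forall (I : countType) (F : I -> set T) :
  (forall i, measurable (F i)) -> measurable [set w | forall i, F i w].
Proof.
move=> mF.
rewrite (_ : mkset _ = \bigcap_n (if unpickle n is Some i then F i else setT)).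
  by apply: bigcapT_measurable => n; case: unpickle.
apply/seteqP; split => w /= Fw.
  by move=> n _; case: unpickle.
by move=> i; have := Fw (pickle i) Logic.I; rewrite pickleK.
Qed.

Lemma measurable_ler_fun (f : T -> R) (b : R) :
  measurable_fun setT f -> measurable [set w | f w <= b].
Proof.
move=> mf; rewrite (_ : mkset _ = f @^-1` `]-oo, b]).
  by rewrite -[X in measurable X]setTI; apply: mf => //; exact: measurable_itv.
by apply/seteqP; split=> w /=; rewrite in_itv.
Qed.

(** The event [lambda1 <= b] is a countable intersection, over integer vectors, of inequalities
    between quadratic forms. The lower bound excludes [lambda1 <= lo - 1 / (n + 1)] for every
    [n]. *)
Lemma measurable_lambda1_itv (q : nat) (S : T -> 'M[R]_q) (lo hi : R) :
  (0 < q)%N -> (forall w, (S w)^T = S w) ->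
  (forall u, measurable_fun setT (fun w => bil (S w) u u)) ->
  measurable [set w | lo <= lambda1 (S w) <= hi].
Proof.
move=> q0 sS mS.
have mle b : measurable [set w | lambda1 (S w) <= b].
  rewrite (_ : mkset _ = [set w | forall m : {ffun 'I_q -> int},
    bil (S w) (\col_j (m j)%:~R) (\col_j (m j)%:~R)
      <= b * nsq (\col_j (m j)%:~R : 'cV[R]_q)]).
    by apply: measurable_forall => m; exact: measurable_ler_fun.
  apply/seteqP; split => w /=.
    by move=> /(lambda1_leP b q0 (sS w)) h m; exact: h.
  by move=> h; apply/(lambda1_leP b q0 (sS w)); exact: bil_le_int.
rewrite (_ : mkset _ = [set w | lambda1 (S w) <= hi] `&`
    [set w | forall n : nat, (~` [set w | lambda1 (S w) <= lo - n.+1%:R^-1]) w]).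
  apply: measurableI => //.
  by apply: measurable_forall => n; exact: measurableC.
apply/seteqP; split => w /=.
  move=> /andP[h1 h2]; split => // n; apply/negP; rewrite -ltNge.
  by apply: lt_le_trans h1; rewrite gtrBl invr_gt0.
move=> [h2 h1]; rewrite h2 andbT leNgt; apply/negP => h.
have dp : 0 < lo - lambda1 (S w) by rewrite subr_gt0.
pose n := Num.truncn (lo - lambda1 (S w))^-1.
apply: (h1 n); rewrite lerBrDr addrC -lerBrDr.
by rewrite invf_ple ?posrE//; apply/ltW/truncnS_gt.
Qed.

Lemma union_bound (P : probability T R) (V : eqType) (s : seq V) (E : V -> set T)
    (b : R) : (forall z, z \in s -> measurable (E z)) ->
  (forall z, z \in s -> (P (E z) <= b%:E)%E) ->
  measurable [set w | exists2 z, z \in s & E z w] /\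
  (P [set w | exists2 z, z \in s & E z w] <= ((size s)%:R * b)%:E)%E.
Proof.
elim: s => [|z s IH] mE hE.
  rewrite (_ : mkset _ = set0); first by rewrite measure0 mul0r.
  by apply/seteqP; split => w // -[].
have [|//|mU PU] := IH.
- by move=> y ys; apply: mE; rewrite inE ys orbT.
- by move=> y ys; apply: hE; rewrite inE ys orbT.
have zs : z \in z :: s by rewrite inE eqxx.
rewrite (_ : mkset _ = E z `|` [set w | exists2 z, z \in s & E z w]); last first.
  apply/seteqP; split => w /=.
    move=> [y]; rewrite inE => /orP[/eqP -> ?|ys ?]; first by left.
    by right; exists y.
  move=> [?|[y ys ?]]; first by exists z.
  by exists y => //; rewrite inE ys orbT.
split; first by apply: measurableU => //; exact: mE.
apply: le_trans (measureU2 _ _ _) _ => //; first exact: mE.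
rewrite [size _]/= -natr1 mulrDl mul1r addrC EFinD.
by apply: leeD => //; exact: hE.
Qed.

End measurability.

Section model.
Context {R : realType} {d : measure_display} {T : measurableType d}.
Context {P : probability T R} {n p k : nat} {beta : R} {v : 'cV[R]_p}.
Context {x : 'I_n -> {RV P >-> p.-tuple R}}.
Hypothesis model : UBSPCA k beta v x.
Hypotheses (beta0 : 0 <= beta) (n0 : (0 < n)%N) (k0 : (0 < k)%N).

Let lin (a : 'cV[R]_p) (t : p.-tuple R) : R := \sum_j a j ord0 * tnth t j.

Let measurable_lin a : measurable_fun setT (lin a).
Proof.
by apply: measurable_sum => j; apply: measurable_funM => //; exact: measurable_tnth.
Qed.

Let measurable_linx a i : measurable_fun setT (fun w => lin a (x i w)).
Proof. by apply: (measurableT_comp (measurable_lin a)); exact: measurable_funP. Qed.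

Lemma bil_sample_cov a w :
  bil (sample_cov x w) a a = n%:R^-1 * \sum_i lin a (x i w) ^+ 2.
Proof.
rewrite /bil /sample_cov -scalemxAl dotZr -mulmxA dot_mulmx trmxK; congr (_ * _).
apply: eq_bigr => i _; rewrite -expr2; congr (_ ^+ 2).
by rewrite mxE; apply: eq_bigr => j _; rewrite mxE mulrC.
Qed.

Lemma sample_cov_sym w : (sample_cov x w)^T = sample_cov x w.
Proof. by rewrite linearZ/= trmx_mul trmxK. Qed.

Lemma measurable_bil_sample_cov a :
  measurable_fun setT (fun w => bil (sample_cov x w) a a).
Proof.
rewrite (_ : (fun w => _) = fun w => n%:R^-1 * \sum_i lin a (x i w) ^+ 2).
  apply: measurable_funM => //; apply: measurable_sum => i.
  exact: measurable_funX.
by apply/funext => w; exact: bil_sample_cov.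
Qed.

(** The second hypothesis says that the linear form [a] has variance 1, so its values on the samples
    are independent standard normal variables and the quadratic form is their chi-square average. *)
Lemma sample_cov_tail a (s : R) : 0 < s -> nsq a + beta * dot v a ^+ 2 = 1 ->
  (P [set w | s <= `| bil (sample_cov x w) a a - 1 |]%R <=
   (2 * expR (- (n%:R * (s * Num.min s 1) / 16)))%:E)%E.
Proof.
move=> s0 a1; have [_ indx gx] := model.
under eq_set do rewrite bil_sample_cov.
apply: chi2_tail => // B mB.
have := indx [set: 'I_n]%SET (fun i => lin a @^-1` B i).
have mB' i : measurable (lin a @^-1` B i).
  by rewrite -[X in measurable X]setTI; exact: measurable_lin.
move=> /(_ mB').
rewrite (_ : [set w | forall i, i \in [set: 'I_n]%SET -> _] =
    [set w | forall i, B i (lin a (x i w))]); last first.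
  by apply/seteqP; split => w /= h i; [apply: h; rewrite inE|move=> _; exact: h].
move=> ->; rewrite (eq_bigl xpredT); last by move=> i; rewrite inE.
apply: eq_bigr => i _.
have := gx i a (B i) (mB i).
rewrite mulmx0 [in X in normal_law X]mxE /normal_law.
have -> : (a^T *m (beta *: (v *m v^T) + 1%:M) *m a) ord0 ord0 = 1.
  rewrite -[RHS]a1 -mulmxA mulmxDl mul1mx -scalemxAl -mulmxA.
  have E (y z : 'cV[R]_p) : (y^T *m z) ord0 ord0 = dot y z.
    by rewrite mxE; apply: eq_bigr => j _; rewrite mxE.
  have -> : v *m (v^T *m a) = dot v a *: v.
    by rewrite [v^T *m a]mx11_scalar E mul_mx_scalar.
  rewrite E dotDr !dotZr (dotC a v) /nsq; ring.
by rewrite oner_eq0 sqrtr1.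
Qed.

Let dev w := dev_mx beta v (sample_cov x w).

Let spike1 : nsq v = 1.
Proof.
by have [[<- _ _] _ _] := model; apply: eq_bigr => j _; rewrite expr2.
Qed.

Lemma measurable_bil_dev u : measurable_fun setT (fun w => bil (dev w) u u).
Proof.
under eq_fun do rewrite bil_dev.
by apply: measurable_funB => //; exact: measurable_bil_sample_cov.
Qed.

Lemma measurable_dev_tail u s : measurable [set w | s <= `|bil (dev w) u u|].
Proof.
rewrite (_ : mkset _ = (fun w => `|bil (dev w) u u|) @^-1` `[s, +oo[).
  rewrite -[X in measurable X]setTI.
  have : measurable_fun setT (fun w => `|bil (dev w) u u|).
    by apply: measurableT_comp => //; exact: measurable_bil_dev.
  by apply => //; exact: measurable_itv.
by apply/seteqP; split=> w /=; rewrite in_itv/= andbT.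
Qed.

(** Stated on the ball because net points need not be unit vectors: normalising [u] can only
    increase the form in absolute value, and for [u = 0] the event is empty. *)
Lemma dev_tail u (s : R) : 0 < s -> nsq u <= 1 ->
  (P [set w | s <= `|bil (dev w) u u|]%R <=
   (2 * expR (- (n%:R * (s * Num.min s 1) / 16)))%:E)%E.
Proof.
move=> s0 u1; have [uz|uz] := eqVneq (nsq u) 0.
  rewrite (_ : mkset _ = set0); first by rewrite measure0 lee_fin mulr_ge0 ?expR_ge0.
  apply/seteqP; split => w //=.
  by rewrite (nsq_eq0 uz) -(scale0r (0 : 'cV_p)) bilZl mul0r normr0 leNgt s0.
have [u0 uE] := normalize uz; set u' := _ *: u in u0 uE.
have := sample_cov_tail s0 (etrans (var_whiten beta0 spike1 u') u0).
apply: le_trans.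
have E w : bil (sample_cov x w) (whiten_mx beta v *m u') (whiten_mx beta v *m u') - 1
    = bil (dev w) u' u'.
  by rewrite bil_dev -/(nsq u') u0.
under [X in (_ <= P X)%E]eq_set do rewrite E.
apply: le_measure; rewrite ?inE; [exact: measurable_dev_tail|exact: measurable_dev_tail|].
move=> w /= h; apply: (le_trans h).
rewrite uE bilZl bilZr mulrA -expr2 sqr_sqrtr ?nsq_ge0//.
by rewrite normrM (ger0_norm (nsq_ge0 _)) ler_piMl.
Qed.

Definition good_event (G : R) : set T := [set w : T |
  forall delta : R, 0 <= delta <= 1 ->
  forall I : {set 'I_p}, #|I| = k ->
    #|I :&: vsupport v|%:R = delta * k%:R ->
    lambda1 (principal_submx (sample_cov x w) I)
      \in `[1 + delta * beta - G, 1 + delta * beta + G + beta / k%:R] ].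

(* [P] is only controlled on measurable sets, so that a lower bound on the
   probability of the event needs its measurability. *)
Lemma measurable_good_event G : measurable (good_event G).
Proof.
have kR : (0 : R) < k%:R by rewrite ltr0n.
(* For given [I] the overlap leaves only one possible [delta], so the uncountable quantifier over
   [delta] disappears and a finite intersection over [I] remains. *)
pose dl (I : {set 'I_p}) : R := #|I :&: vsupport v|%:R / k%:R.
rewrite (_ : good_event G = [set w | forall I : {set 'I_p},
   (if #|I| == k then [set w | 1 + dl I * beta - G <=
      lambda1 (principal_submx (sample_cov x w) I) <=
      1 + dl I * beta + G + beta / k%:R] else setT) w]).
  apply: measurable_forall => I; case: eqP => Ik; last exact: measurableT.
  apply: measurable_lambda1_itv; first by rewrite Ik.
    move=> w; apply/matrixP => i j.
    have sS := congr1 (fun A : 'M[R]_p => A (enum_val j) (enum_val i)) (sample_cov_sym w).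
    rewrite /= [LHS]mxE in sS.
    by rewrite mxE [LHS]mxE [RHS]mxE sS.
  move=> u; under eq_fun do rewrite principal_submxE.
  exact: measurable_bil_sample_cov.
apply/seteqP; split => w /=.
  move=> h I; case: eqP => // Ik /=.
  have dI : 0 <= dl I <= 1.
    rewrite divr_ge0 ?ler0n//= ler_pdivrMr// mul1r ler_nat -Ik.
    by apply: subset_leq_card; exact: subsetIl.
  have dlE : #|I :&: vsupport v|%:R = dl I * k%:R by rewrite divfK// gt_eqF.
  by have := h _ dI I Ik dlE; rewrite in_itv.
move=> h delta _ I Ik hd; have := h I.
by move/eqP: (Ik) => ->; rewrite in_itv/= /dl hd mulfK// gt_eqF.
Qed.

(** The nets live in dimension at most [2 k], the size of [I] united with the support, whence
    [2 ^ (18 * (2 * k))] points per set. The coefficient 6 is the 3 of [deviation_bound] times the 2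
    lost between the net and the ball. The second tail is that of the single vector [v]. *)
Lemma good_event_prob (e f G : R) : 0 < e -> 0 < f ->
  6 * Num.sqrt (1 + beta) * e + (1 + beta) * f <= G ->
  ((1 - (('C(p, k) * 2 ^ (36 * k))%:R * (2 * expR (- (n%:R * (e * Num.min e 1) / 16)))
     + 2 * expR (- (n%:R * (f * Num.min f 1) / 16))))%:E <= P (good_event G))%E.
Proof.
move=> e0 f0 hG; have [vk _ _] := model.
pose S := vsupport v.
have k2 : (0 < 2 * k)%N by rewrite muln_gt0.
have netI (I : {set 'I_p}) : exists s : seq 'cV[R]_p, #|I| = k ->
    (size s <= 2 ^ (36 * k))%N /\
    forall u, supported (I :|: S) u -> nsq u <= 1 -> exists z,
    [/\ z \in s, supported (I :|: S) z, nsq z <= 1 & nsq (u - z) <= 16^-1].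
  have [Ik|Ik] := pselect (#|I| = k); last by exists [::] => /Ik.
  have hI : (#|I :|: S| <= 2 * k)%N.
    rewrite (leq_trans (leq_card_setU _ _))// Ik mul2n -addnn leq_add2l.
    by case: vk => _ <-.
  have [s [s1 s2]] := @net_exists R _ _ _ k2 hI; exists s => _; split => //.
  by move: s1; rewrite mulnA.
pose net (I : {set 'I_p}) := sval (cid (netI I)).
have netP (I : {set 'I_p}) := svalP (cid (netI I)).
pose L := flatten [seq net J | J <- enum [set J : {set 'I_p} | #|J| == k]%SET].
have sL : (size L <= 'C(p, k) * 2 ^ (36 * k))%N.
  have -> : 'C(p, k) = size (enum [set J : {set 'I_p} | #|J| == k]%SET).
    by rewrite -cardE card_draws card_ord.
  rewrite /L.
  have : all (fun I : {set 'I_p} => #|I| == k)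
      (enum [set I : {set 'I_p} | #|I| == k]%SET).
    by apply/allP => I; rewrite mem_enum inE.
  elim: (enum _) => //= I l IH /andP[/eqP Ik hl].
  by rewrite size_cat mulSn leq_add// ?IH//; have [] := netP I Ik.
set b1 := 2 * expR _; set b2 := 2 * expR _.
(* The nets may list points outside the unit ball, for which there is no tail bound; the first
   condition makes their bad event empty. *)
pose Bad z := [set w | nsq z <= 1 /\ e <= `|bil (dev w) z z|].
have mBad z : measurable (Bad z) /\ (P (Bad z) <= b1%:E)%E.
  have [z1|z1] := leP (nsq z) 1.
    rewrite (_ : Bad z = [set w | e <= `|bil (dev w) z z|]).
      by split; [exact: measurable_dev_tail|exact: dev_tail].
    by apply/seteqP; split => w //= -[].
  rewrite (_ : Bad z = set0).
    by split => //; rewrite measure0 lee_fin mulr_ge0 ?expR_ge0.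
  by apply/seteqP; split => w //= -[]; rewrite leNgt z1.
have [mU PU] := @union_bound R d T P _ L Bad b1 (fun z _ => (mBad z).1)
  (fun z _ => (mBad z).2).
set U := mkset _ in mU PU.
pose V := [set w | f <= `|bil (dev w) v v|].
have mV : measurable V by exact: measurable_dev_tail.
have PV : (P V <= b2%:E)%E by apply: dev_tail => //; rewrite spike1.
have mG := measurable_good_event G.
have sub : ~` good_event G `<=` U `|` V.
  move=> w /= Gw; apply: contrapT => /not_orP[nU nV]; apply: Gw.
  move=> delta _; apply: (@lambda1_deviation R p beta v beta0 spike1 k k0 vk
    (sample_cov x w) (2 * e) f G (sample_cov_sym w)).
  - move=> I Ik; have [_ hnet] := netP I Ik.
    apply: (bil_le_net _ hnet); first exact/dev_mx_sym/sample_cov_sym.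
    move=> z zs z1; rewrite leNgt; apply/negP => ez; apply: nU; exists z.
      apply/flattenP; exists (net I) => //; apply/mapP; exists I => //.
      by rewrite mem_enum inE Ik.
    by split => //; exact: ltW.
  - by rewrite leNgt; apply/negP => /ltW.
  - by apply: le_trans hG; rewrite lerD2r; lra.
have : (P (~` good_event G) <= (('C(p, k) * 2 ^ (36 * k))%:R * b1 + b2)%:E)%E.
  apply: (@le_trans _ _ (P (U `|` V))).
    by apply: le_measure; rewrite ?inE//; [exact: measurableC|exact: measurableU].
  apply: le_trans (measureU2 _ mU mV) _; rewrite EFinD; apply: leeD => //.
  apply: le_trans PU _; rewrite lee_fin ler_wpM2r// ?ler_nat//.
  by rewrite mulr_ge0// expR_ge0.
rewrite probability_setC// => h.
have fG : P (good_event G) \is a fin_num by exact: fin_num_measure.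
move: h; rewrite -(fineK fG) -EFinB !lee_fin; lra.
Qed.

End model.

Arguments good_event {R d T P n p} k beta v x G.

(** * Counting the net points and choosing the thresholds *)

Lemma leq_bin_expn (p k : nat) : ('C(p, k) <= p ^ k)%N.
Proof.
apply: (@leq_trans (p ^_ k)); first by rewrite -bin_ffact leq_pmulr// fact_gt0.
rewrite ffact_prod -[k in (_ ^ k)%N]card_ord -prod_nat_const.
by apply: leq_prod => i _; exact: leq_subr.
Qed.

Lemma leq_bin_exp2 (p k : nat) : ('C(p, k) <= 2 ^ p)%N.
Proof.
have := card_draws 'I_p k; rewrite card_ord => <-.
have := card_powerset [set: 'I_p]; rewrite cardsT card_ord => <-.
by apply: subset_leq_card; apply/fintype.subsetP => A _; rewrite powersetE finset.subsetT.
Qed.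

Section log_count.
Context {R : realType}.

Lemma exp2_le_expR m : 2 ^+ m <= expR m%:R :> R.
Proof.
rewrite -[m%:R]mulr1 expRM_natl; apply: lerXn2r; rewrite ?nnegrE ?expR_ge0//.
by apply: le_trans (expR_ge1Dx 1); lra.
Qed.

(** The bound [p ^ k] on the binomial gives the scale [k ln n], the bound [2 ^ p] gives the scale
    [n]. The constant 37 is 36 for the nets plus 1 for the choice of the set. The assumption
    [1 <= ln n] absorbs [ln (c + 1) <= c] into [c * ln n]. *)
Lemma net_size_le (c : R) (n p k : nat) : 0 < c -> (0 < k)%N -> (k <= p)%N ->
  p%:R <= (c + 1) * n%:R -> 1 <= ln n%:R :> R ->
  ('C(p, k) * 2 ^ (36 * k))%:R
    <= expR (37 * (c + 1) * Num.min (k%:R * ln n%:R) n%:R).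
Proof.
move=> c0 k0 kp pn ln1.
have n0 : (0 : R) < n%:R.
  rewrite ltr0n lt0n; apply/eqP => nz.
  by move: ln1; rewrite nz ln0//; lra.
have kR : (1 : R) <= k%:R by rewrite ler1n.
have p0 : (0 : R) < p%:R by rewrite ltr0n (leq_trans k0).
have kpR : k%:R <= p%:R :> R by rewrite ler_nat.
have E36 : (2 ^ (36 * k))%:R <= expR (36 * k%:R) :> R.
  by rewrite natrX (le_trans (exp2_le_expR _))// natrM.
have E36' := expR_ge0 (36 * k%:R : R).
have b1 : ('C(p, k) * 2 ^ (36 * k))%:R <= expR (37 * (c + 1) * n%:R).
  rewrite natrM; apply: (@le_trans _ _ (expR p%:R * expR (36 * k%:R))).
    apply: ler_pM => //; apply: (@le_trans _ _ (2 ^ p)%:R).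
      by rewrite ler_nat leq_bin_exp2.
    by rewrite natrX exp2_le_expR.
  rewrite -expRD ler_expR -mulrA; lra.
have b2 : ('C(p, k) * 2 ^ (36 * k))%:R <= expR (37 * (c + 1) * (k%:R * ln n%:R)).
  rewrite natrM; apply: (@le_trans _ _ (expR (k%:R * ln p%:R) * expR (36 * k%:R))).
    apply: ler_pM => //; apply: (@le_trans _ _ (p ^ k)%:R).
      by rewrite ler_nat leq_bin_expn.
    by rewrite natrX expRM_natl lnK// posrE.
  rewrite -expRD ler_expR.
  have lp : ln p%:R <= (c + 1) * ln n%:R.
    apply: (@le_trans _ _ (ln ((c + 1) * n%:R))).
      by rewrite ler_ln ?posrE// mulr_gt0//; lra.
    rewrite lnM ?posrE//; last by lra.
    have h : ln (c + 1) <= c by rewrite addrC le_ln1Dx//; lra.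
    have : c <= c * ln n%:R by rewrite ler_peMr// ltW.
    rewrite mulrDl mul1r; lra.
  have h1 : k%:R * ln p%:R <= k%:R * ((c + 1) * ln n%:R) by rewrite ler_wpM2l.
  have h2 : k%:R <= k%:R * ((c + 1) * ln n%:R).
    by rewrite ler_peMr// -[leLHS]mulr1 ler_pM//; lra.
  have -> : 37 * (c + 1) * (k%:R * ln n%:R) =
     k%:R * ((c + 1) * ln n%:R) + 36 * (k%:R * ((c + 1) * ln n%:R)) by ring.
  by rewrite lerD// ler_wpM2l.
by case: (leP (k%:R * ln n%:R) (n%:R : R)).
Qed.

(** The Bernstein exponent at [s = A sqrt x] is at least linear in [x] in both regimes:
    [s^2 = A^2 x] when [s <= 1], and [s = A sqrt x >= A x] otherwise, because [x <= 1]. *)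
Lemma sqrt_threshold (A x : R) : 1 <= A -> 0 < x -> x <= 1 ->
  A * x <= A * Num.sqrt x * Num.min (A * Num.sqrt x) 1.
Proof.
move=> A1 x0 x1.
have s0 : 0 <= Num.sqrt x by exact: sqrtr_ge0.
have s1 : Num.sqrt x <= 1 by rewrite -(@sqrtr1 R) ler_wsqrtr.
have sx : x = Num.sqrt x * Num.sqrt x by rewrite -expr2 sqr_sqrtr// ltW.
have xs : x <= Num.sqrt x by rewrite {1}sx ler_piMl.
have A0 : 0 <= A by lra.
case: (leP (A * Num.sqrt x) 1) => _.
  by rewrite mulrACA -sx -mulrA ler_wpM2l// ler_peMl// ltW.
by rewrite mulr1 ler_wpM2l.
Qed.

End log_count.

Section high_probability.
Context {R : realType} {d : measure_display} {T : measurableType d}.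
Context {P : probability T R} {n p k : nat} {beta : R} {v : 'cV[R]_p}.
Context {x : 'I_n -> {RV P >-> p.-tuple R}}.

(* The constant is [7 A] for [A = 16 (L + 1)], where [exp (L min (k ln n) n)]
   bounds the number of net points ([net_size_le]), the tails decay like
   [exp (- n s^2 / 16)], and [7 = 6 + 1] comes from [good_event_prob]. *)
Lemma good_event_high_prob (c : R) : UBSPCA k beta v x -> 0 <= beta -> 0 < c ->
  (0 < k)%N -> p%:R <= (c + 1) * n%:R -> 1 <= ln n%:R :> R ->
  ((1 - 4 * (1 + beta) / (minn k n)%:R)%:E <=
    P (good_event k beta v x
        (Gamma (112 * (37 * (c + 1) + 1)) beta n k)))%E.
Proof.
move=> model beta0 c0 k0 pn ln1.
have nR : (0 : R) < n%:R.
  rewrite ltr0n lt0n; apply/eqP => nz.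
  by move: ln1; rewrite nz ln0//; lra.
have n0 : (0 < n)%N by rewrite -(ltr0n R).
have kR : (1 : R) <= k%:R by rewrite ler1n.
have kp : (k <= p)%N.
  by have [[_ <- _] _ _] := model; rewrite -[leqRHS]card_ord max_card.
have NB := net_size_le c0 k0 kp pn ln1.
set mu := Num.min _ _ in NB.
have muE : (minn k n)%:R <= mu.
  rewrite natr_min /mu le_min !ge_min lexx orbT andbT.
  by rewrite (ler_peMr (ler0n _ k) ln1).
have mn0 : (0 : R) < (minn k n)%:R by rewrite ltr0n leq_min k0.
have mu0 : 0 < mu by apply: lt_le_trans muE.
pose L : R := 37 * (c + 1).
pose A : R := 16 * (L + 1).
have L0 : 0 < L by rewrite mulr_gt0//; lra.
have A1 : 1 <= A by rewrite /A; lra.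
have B0 : 0 < 1 + beta by lra.
pose t := mu / n%:R.
have t0 : 0 < t by rewrite divr_gt0.
have t1 : t <= 1 by rewrite ler_pdivrMr// mul1r ge_min lexx orbT.
(* Chosen so that [(1 + beta) sqrt t' = sqrt ((1 + beta) t)], the same order as the contribution of
   [e]. *)
pose t' := t / (1 + beta).
have t'0 : 0 < t' by rewrite divr_gt0.
have t'1 : t' <= 1 by rewrite ler_pdivrMr// mul1r; lra.
pose e := A * Num.sqrt t; pose f := A * Num.sqrt t'.
have A0 : 0 < A by lra.
have e0 : 0 < e by rewrite mulr_gt0// sqrtr_gt0.
have f0 : 0 < f by rewrite mulr_gt0// sqrtr_gt0.
have r0 : 0 < Num.sqrt (1 + beta) by rewrite sqrtr_gt0.
have hG : 6 * Num.sqrt (1 + beta) * e + (1 + beta) * f <=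
    Gamma (112 * (37 * (c + 1) + 1)) beta n k.
  have fE : (1 + beta) * f = A * (Num.sqrt (1 + beta) * Num.sqrt t).
    rewrite /f /t' sqrtrM ?(ltW t0)// sqrtrV ?(ltW B0)//.
    have BE : 1 + beta = Num.sqrt (1 + beta) * Num.sqrt (1 + beta).
      by rewrite -expr2 sqr_sqrtr// ltW.
    by rewrite {1}BE; field; rewrite gt_eqF.
  rewrite fE /e -sqrtrM ?(ltW B0)//.
  have -> : 6 * Num.sqrt (1 + beta) * (A * Num.sqrt t) +
      A * Num.sqrt ((1 + beta) * t) = 7 * A * Num.sqrt ((1 + beta) * t).
    by rewrite (sqrtrM _ (ltW B0)); ring.
  rewrite /Gamma (_ : 112 * _ = 7 * A); last by rewrite /A /L; ring.
  have A7 : 0 <= 7 * A by rewrite mulr_ge0// ltW.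
  apply: (ler_wpM2l A7); apply: ler_wsqrtr.
  rewrite -2!mulrA; apply: ler_wpM2l; first exact: ltW.
  by rewrite mulrA ler_pM2r ?invr_gt0// ge_min lexx.
apply: le_trans (good_event_prob model beta0 n0 k0 e0 f0 hG).
have he := sqrt_threshold A1 t0 t1; have hf := sqrt_threshold A1 t'0 t'1.
have xe : n%:R * (A * t) / 16 = (L + 1) * mu.
  by rewrite /A /t; field; rewrite gt_eqF.
have xf : n%:R * (A * t') / 16 = (L + 1) * (mu / (1 + beta)).
  by rewrite /A /t' /t; field; rewrite !gt_eqF.
have ge' : (L + 1) * mu <= n%:R * (e * Num.min e 1) / 16.
  by rewrite -xe ler_wpM2r// ler_wpM2l// ltW.
have gf : (L + 1) * (mu / (1 + beta)) <= n%:R * (f * Num.min f 1) / 16.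
  by rewrite -xf ler_wpM2r// ler_wpM2l// ltW.
pose y := mu / (1 + beta).
have y0 : 0 < y by rewrite divr_gt0.
have ymu : y <= mu by rewrite ler_pdivrMr// ler_peMr// ?(ltW mu0)//; lra.
(* The tail exponent [(L + 1) mu] beats the count [L mu] with [mu] to spare, and [mu >= y]. *)
have T1 : ('C(p, k) * 2 ^ (36 * k))%:R *
    (2 * expR (- (n%:R * (e * Num.min e 1) / 16))) <= 2 * expR (- y).
  rewrite mulrCA ler_pM2l//.
  apply: (@le_trans _ _ (expR (L * mu) * expR (- ((L + 1) * mu)))).
    by apply: ler_pM; rewrite ?expR_ge0// ler_expR lerN2.
  by rewrite -expRD ler_expR mulrDl; lra.
have T2 : 2 * expR (- (n%:R * (f * Num.min f 1) / 16)) <= 2 * expR (- y).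
  rewrite ler_pM2l// ler_expR lerN2; apply: le_trans gf.
  rewrite -/y mulrDl mul1r lerDr mulr_ge0//; exact: ltW.
(* Uses [exp (- y) <= 1 / y] and [mu >= min(k, n)]: a weak rate, but explicit and enough for
   convergence. Two terms [2 exp (- y)] give the factor 4. *)
have T3 : expR (- y) <= (1 + beta) / (minn k n)%:R.
  rewrite expRN; apply: (@le_trans _ _ y^-1).
    rewrite lef_pV2 ?posrE ?expR_gt0//; apply: le_trans (expR_ge1Dx y).
    by rewrite lerDr.
  rewrite /y invf_div ler_pM2l// lef_pV2 ?posrE//.
rewrite lee_fin -mulrA; lra.
Qed.

End high_probability.

Theorem theorem4p3 (R : realType) (c : R) (hc : 0 < c) :
  exists2 C : R, 0 < C &
  forall beta : R, 0 <= beta ->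
  forall n p k : nat -> nat,
    n @ \oo --> \oo -> p @ \oo --> \oo -> k @ \oo --> \oo ->
    (fun m => (p m)%:R / (n m)%:R : R) @ \oo --> c ->
  forall (d : nat -> measure_display) (T : forall m, measurableType (d m))
    (P : forall m, probability (T m) R) (v : forall m, 'cV[R]_(p m))
    (x : forall m, 'I_(n m) -> {RV P m >-> (p m).-tuple R}),
    (forall m, UBSPCA (k m) beta (v m) (x m)) ->
    (fun m => P m [set w : T m |
       forall delta : R, 0 <= delta <= 1 ->
       forall I : {set 'I_(p m)}, #|I| = k m ->
         #|I :&: vsupport (v m)|%:R = delta * (k m)%:R ->
         lambda1 (principal_submx (sample_cov (x m) w) I)
           \in `[1 + delta * beta - Gamma C beta (n m) (k m),
                 1 + delta * beta + Gamma C beta (n m) (k m)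
                   + beta / (k m)%:R] ]) @ \oo --> 1%E.
Proof.
exists (112 * (37 * (c + 1) + 1)); first by lra.
move=> beta beta0 n p k nny _ kny pnc d T P v x model.
set G := fun m => P m _.
have GE m : G m = P m (good_event (k m) beta (v m) (x m)
    (Gamma (112 * (37 * (c + 1) + 1)) beta (n m) (k m))) by [].
have n_ge N : \forall m \near \oo, (N <= n m)%N by exact: ((cvgnyPge n).1 nny N).
have k_ge N : \forall m \near \oo, (N <= k m)%N by exact: ((cvgnyPge k).1 kny N).
(* The lower bound tends to 1 because both [k m] and [n m] diverge while [beta] stays fixed. *)
apply: (@squeeze_cvge _ _ _ _
  (fun m => (1 - 4 * (1 + beta) / (minn (k m) (n m))%:R)%:E) G (cst 1%E)).
- have pn : \forall m \near \oo, (p m)%:R / (n m)%:R <= c + 1 :> R.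
    by apply: (cvgr_le _ pnc); rewrite ltrDl.
  near=> m.
  have k0 : (0 < k m)%N by near: m.
  (* This forces [n m] to exceed [exp 1], hence [1 <= ln (n m)]. *)
  have ne : (Num.truncn (expR 1 : R) < n m)%N by near: m.
  have n0 : (0 < n m)%N by exact: leq_trans ne.
  have nR : (0 : R) < (n m)%:R by rewrite ltr0n.
  apply/andP; split.
    rewrite GE; apply: good_event_high_prob => //.
      by rewrite -ler_pdivrMr//; near: m.
    rewrite -[leLHS]expRK ler_ln ?posrE ?expR_gt0//.
    by apply: (le_trans (ltW (truncnS_gt _))); rewrite ler_nat.
  by rewrite GE; apply: probability_le1; apply: measurable_good_event.
- apply: cvg_EFin.
    exact: nearW.
  apply/cvgrPdist_le => eps eps0; near=> m.
  have K0 : 0 <= 4 * (1 + beta) by rewrite mulr_ge0//; lra.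
  rewrite /= opprB addrCA subrr addr0 ger0_norm; last by rewrite divr_ge0.
  have k1 : (Num.truncn (4 * (1 + beta) / eps) < k m)%N by near: m.
  have n1 : (Num.truncn (4 * (1 + beta) / eps) < n m)%N by near: m.
  have h : (Num.truncn (4 * (1 + beta) / eps) < minn (k m) (n m))%N.
    by rewrite leq_min k1.
  rewrite ler_pdivrMr; last by rewrite ltr0n (leq_trans _ h).
  rewrite [leRHS]mulrC -ler_pdivrMr//; apply: (le_trans (ltW (truncnS_gt _))).
  by rewrite ler_nat.
- exact: cvg_cst.
Unshelve. all: by end_near. Qed.
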